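(* Let $G$ be a countably infinite locally nilpotent group. If $\mathrm{tor}\,G$ is infinite and $G/\mathrm{tor}\,G$ is finitely generated, then $|\mathrm{Aut}\,G|=2^{\aleph_0}$.
   Context: For a locally nilpotent group $G$, $\mathrm{tor}\,G$ denotes its torsion subgroup, i.e. the (characteristic) subgroup of all elements of finite order. *)

(* Defs.v *)
From HB Require Import structures.
From mathcomp Require Import all_boot.
From mathcomp Require Import boolp classical_sets functions cardinality.

Set Implicit Arguments.
Unset Strict Implicit.
Unset Printing Implicit Defensive.

Local Open Scope classical_set_scope.
Local Open Scope group_scope.

Section Subgroups.
Variable G : groupType.
Implicit Types A H K N : set G.

Definition is_subgroup H := H 1 /\ forall x y, H x -> H y -> H (x / y).

Definition is_normal_subgroup N :=
  is_subgroup N /\ forall x g, N x -> N (x ^ g).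

Definition generated A : set G := smallest is_subgroup A.

Definition finitely_generated H := exists2 A, finite_set A & H = generated A.

Definition comm_subgroup H K : set G :=
  generated [set z | exists x y, [/\ H x, K y & z = [~ x, y]]].

(* lower_central H n is the term usually written gamma_(n+1)(H). *)
Fixpoint lower_central H n : set G :=
  if n is m.+1 then comm_subgroup (lower_central H m) H else H.

Definition is_nilpotent H := exists n, lower_central H n = [set 1].

Definition torsion : set G := [set x | exists2 n, 0 < n & x ^+ n = 1].

End Subgroups.

Arguments torsion G : clear implicits.

Definition locally_nilpotent (G : groupType) :=
  forall H : set G, finitely_generated H -> is_nilpotent H.

Definition automorphisms (G : groupType) : set (G -> G) :=
  [set f | bijective f /\ {morph f : x y / x * y}].

Arguments automorphisms G : clear implicits.

Section Quotient.
Variables (G : groupType) (N : set G) (nN : is_normal_subgroup N).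

Definition coset_rel (x y : G) : bool := `[< N (x^-1 * y) >].

Lemma normal1 : N 1. Proof. by case: nN => -[]. Qed.

Lemma normalV x : N x -> N x^-1.
Proof. by case: nN => -[N1 NF] _ /(NF _ _ N1); rewrite mul1g. Qed.

Lemma normalM x y : N x -> N y -> N (x * y).
Proof.
by move=> Nx /normalV Ny; case: nN => -[_ /(_ _ _ Nx Ny)]; rewrite invgK.
Qed.

Lemma normalJ x g : N x -> N (x ^ g). Proof. by case: nN => _; apply. Qed.

Lemma coset_rel_refl : reflexive coset_rel.
Proof. by move=> x; apply/asboolP; rewrite mulVg; apply: normal1. Qed.

Lemma coset_rel_sym : symmetric coset_rel.
Proof.
have E x y : N (x^-1 * y) -> N (y^-1 * x).
  by move/normalV; rewrite invgM invgK.
by move=> x y; apply/asboolP/asboolP; apply: E.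
Qed.

Lemma coset_rel_trans : transitive coset_rel.
Proof.
move=> y x z /asboolP Nxy /asboolP Nyz; apply/asboolP.
by have := normalM Nxy Nyz; rewrite mulgA mulgK.
Qed.

Definition coset_equiv :=
  EquivRel coset_rel coset_rel_refl coset_rel_sym coset_rel_trans.

Definition quotient_group := {eq_quot coset_equiv}%qT.

HB.instance Definition _ := Choice.on quotient_group.

Definition quotient_pi (x : G) : quotient_group := (\pi_{eq_quot coset_equiv} x)%qT.

Definition quotient_mul (X Y : quotient_group) : quotient_group :=
  quotient_pi (repr X * repr Y).

Definition quotient_inv (X : quotient_group) : quotient_group :=
  quotient_pi (repr X)^-1.

Lemma quotient_piP x y : quotient_pi x = quotient_pi y <-> N (x^-1 * y).
Proof.
split=> [/eqmodP/asboolP //|Nxy].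
by apply/eqmodP/asboolP.
Qed.

Lemma quotient_reprK X : quotient_pi (repr X) = X.
Proof. exact: reprK. Qed.

Lemma quotient_repr x : N (x^-1 * repr (quotient_pi x)).
Proof. by apply/quotient_piP; rewrite quotient_reprK. Qed.

Lemma quotient_piM x y :
  quotient_mul (quotient_pi x) (quotient_pi y) = quotient_pi (x * y).
Proof.
apply/esym/quotient_piP; rewrite invgM.
have := normalM (normalJ y (quotient_repr x)) (quotient_repr y).
by rewrite conjgE -!mulgA mulVKg.
Qed.

Lemma quotient_piV x : quotient_inv (quotient_pi x) = quotient_pi x^-1.
Proof.
apply/quotient_piP; rewrite invgK.
by have := normalJ x^-1 (quotient_repr x); rewrite conjgE invgK mulgA mulVKg.
Qed.

Lemma quotient_mulA : associative quotient_mul.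
Proof.
move=> X Y Z; rewrite -(quotient_reprK X) -(quotient_reprK Y).
by rewrite -(quotient_reprK Z) !quotient_piM mulgA.
Qed.

Lemma quotient_mul1 : left_id (quotient_pi 1) quotient_mul.
Proof.
by move=> X; rewrite -(quotient_reprK X) quotient_piM mul1g.
Qed.

Lemma quotient_mulr1 : right_id (quotient_pi 1) quotient_mul.
Proof.
by move=> X; rewrite -(quotient_reprK X) quotient_piM mulg1.
Qed.

Lemma quotient_mulV : left_inverse (quotient_pi 1) quotient_inv quotient_mul.
Proof.
by move=> X; rewrite -(quotient_reprK X) quotient_piV quotient_piM mulVg.
Qed.

Lemma quotient_mulrV : right_inverse (quotient_pi 1) quotient_inv quotient_mul.
Proof.
by move=> X; rewrite -(quotient_reprK X) quotient_piV quotient_piM mulgV.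
Qed.

HB.instance Definition _ := isGroup.Build quotient_group
  quotient_mulA quotient_mul1 quotient_mulr1 quotient_mulV quotient_mulrV.

End Quotient.

Section TorsionNormal.
Variable G : groupType.
Implicit Types (A H : set G) (x y z : G).

Lemma generated_subgroup A : is_subgroup (generated A).
Proof.
split=> [K [[K1 _] _] //|x y Ax Ay K KA].
by case: (KA) => -[_ KF] _; apply: KF; [apply: Ax | apply: Ay].
Qed.

Lemma sub_generated A : A `<=` generated A.
Proof. exact: sub_smallest. Qed.

Lemma generated_min A H : is_subgroup H -> A `<=` H -> generated A `<=` H.
Proof. by move=> sH AH x; apply; split. Qed.

Lemma subgroupV H x : is_subgroup H -> H x -> H x^-1.
Proof. by move=> [H1 HF] Hx; rewrite -[x^-1]mul1g; apply: HF. Qed.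

Lemma subgroupM H x y : is_subgroup H -> H x -> H y -> H (x * y).
Proof.
move=> sH Hx Hy; rewrite -[y]invgK; case: (sH) => _; apply=> //.
exact: subgroupV.
Qed.

Lemma subgroupX H x n : is_subgroup H -> H x -> H (x ^+ n).
Proof.
move=> sH Hx; elim: n => [|n IHn]; first by case: sH.
by rewrite expgS; apply: subgroupM.
Qed.

Section LowerCentral.
Variables (H : set G) (sH : is_subgroup H).
Local Notation L := (lower_central H).

Lemma lower_central_subgroup n : is_subgroup (L n).
Proof. by case: n => [|n] //=; apply: generated_subgroup. Qed.

Lemma lower_central_comm n x y : L n x -> H y -> L n.+1 [~ x, y].
Proof. by move=> Lx Hy; apply: sub_generated; exists x, y. Qed.

Lemma lower_central_le n : L n.+1 `<=` L n.
Proof.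
elim: n => [|n IHn] /=.
  apply: generated_min => // _ [x [y [Hx Hy ->]]].
  rewrite commgEl conjgE; apply: subgroupM => //; first exact: subgroupV.
  by apply: subgroupM => //; [apply: subgroupV | apply: subgroupM].
apply: generated_min => [|_ [x [y [Lx Hy ->]]]].
  exact: (lower_central_subgroup n.+1).
exact: (lower_central_comm (IHn _ Lx) Hy).
Qed.

Lemma lower_central_sub n : L n `<=` H.
Proof. by elim: n => [//|n IHn] x /lower_central_le/IHn. Qed.

Lemma lower_centralJ n x y : L n x -> H y -> L n (x ^ y).
Proof.
move=> Lx Hy; rewrite -[x ^ y](mulVKg x) -commgEl.
apply: (subgroupM (lower_central_subgroup n) Lx).
exact: (lower_central_le (lower_central_comm Lx Hy)).
Qed.

Let E n x y := L n (x^-1 * y).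

Let E_refl n x : E n x x.
Proof. by rewrite /E mulVg; case: (lower_central_subgroup n). Qed.

Let E_trans n y x z : E n x y -> E n y z -> E n x z.
Proof.
move=> /(subgroupM (lower_central_subgroup n))/[apply].
by rewrite mulgA mulgK.
Qed.

Let E_mul n x y z t : H z -> E n x y -> E n z t -> E n (x * z) (y * t).
Proof.
move=> Hz Exy Ezt; rewrite /E.
have := subgroupM (lower_central_subgroup n) (lower_centralJ Exy Hz) Ezt.
by rewrite conjgE invgM -!mulgA mulVKg.
Qed.

Let E_in n x y : E n x y -> L n x -> L n y.
Proof.
move=> Exy Lx; rewrite -[y](mulVKg x).
exact: subgroupM (lower_central_subgroup n) Lx Exy.
Qed.

Let E_sym n x y : E n x y -> E n y x.
Proof.
move=> /(subgroupV (lower_central_subgroup n)).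
by rewrite /E invgM invgK.
Qed.

Let E_comm n x y : L n x -> H y -> E n.+1 (y * x) (x * y).
Proof.
by move=> Lx Hy; rewrite /E invgM -mulgA; apply: lower_central_comm.
Qed.

Let P n x := L n x /\ exists2 k, 0 < k & L n.+1 (x ^+ k).

Let expMn n x y k : L n x -> L n y -> E n.+1 ((x * y) ^+ k) (x ^+ k * y ^+ k).
Proof.
move=> Lx Ly; have [Hx Hy] := (lower_central_sub Lx, lower_central_sub Ly).
elim: k => [|k IHk]; first by rewrite !expg0 mulg1; apply: E_refl.
rewrite !expgSr.
apply: (E_trans (E_mul (subgroupM sH Hx Hy) IHk (E_refl _ _))).
have Hxk := subgroupX k sH Hx; have Hyk := subgroupX k sH Hy.
rewrite -!mulgA; apply: E_mul; [|exact: E_refl|].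
  by do 2 ?apply: subgroupM.
rewrite !mulgA; apply: E_mul; [by []| |exact: E_refl].
exact: E_comm.
Qed.

Let P_subgroup n : is_subgroup (P n).
Proof.
have sL := lower_central_subgroup.
split=> [|x y [Lx [k k0 Lxk]] [Ly [l l0 Lyl]]].
  split; first by case: (sL n).
  by exists 1%N => //; case: (sL n.+1).
have LyV := subgroupV (sL n) Ly.
split; first exact: subgroupM.
exists (k * l)%N; first by rewrite muln_gt0 k0.
apply: E_in (E_sym (expMn (k * l) Lx LyV)) _.
apply: (subgroupM (sL n.+1)); first by rewrite expgnA; exact: (subgroupX _ (sL n.+1)).
rewrite mulnC expgnA expVgn; apply: (subgroupX _ (sL n.+1)).
exact: (subgroupV (sL n.+1)).
Qed.

Lemma lower_central_tor A n x : H = generated A -> A `<=` torsion G ->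
  L n x -> exists2 k, 0 < k & L n.+1 (x ^+ k).
Proof.
move=> HA tA; have sL := lower_central_subgroup.
suff LP : L n `<=` P n by move/LP => [].
elim: n => [|n IHn].
  rewrite [X in X `<=` _]HA; apply: (generated_min (P_subgroup 0)) => a Aa.
  split; first by rewrite /= HA; apply: sub_generated.
  by have [k k0 ak1] := tA _ Aa; exists k => //; rewrite ak1; case: (sL 1%N).
apply: (generated_min (P_subgroup n.+1)) => _ [y [h [Ly Hh ->]]].
have Lc := lower_central_comm Ly Hh; split=> //.
have [_ [k k0 Lyk]] := IHn _ Ly; exists k => //.
suff Ek : E n.+2 [~ y ^+ k, h] ([~ y, h] ^+ k).
  exact: (E_in Ek (lower_central_comm Lyk Hh)).
move=> {k0 Lyk}.
have Hy := lower_central_sub Ly; have Hc := lower_central_sub Lc.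
elim: k => [|k IHk].
  rewrite !expg0 comm1g; exact: (E_refl n.+2 1).
rewrite !expgSr.
have -> : [~ y ^+ k * y, h] = [~ y ^+ k, h] ^ y * [~ y, h].
  by rewrite !commgEl !conjgE !invgM -!mulgA !mulVKg.
suff Ec : E n.+2 ([~ y ^+ k, h] ^ y) [~ y ^+ k, h].
  exact: (E_mul Hc (E_trans Ec IHk) (E_refl n.+2 _)).
apply: (@E_sym n.+2).
rewrite /E -commgEl; apply: (@lower_central_comm n.+1) => //.
by apply: (@lower_central_comm n) => //; apply: (subgroupX _ (sL n)).
Qed.

Lemma generated_tor A x : H = generated A -> A `<=` torsion G ->
  is_nilpotent H -> H x -> torsion G x.
Proof.
move=> HA tA [n Ln1] Hx.
suff [k k0] : exists2 k, 0 < k & L n (x ^+ k).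
  by rewrite Ln1 => xk1; exists k.
elim: n {Ln1} => [|n [k k0 Lxk]]; first by exists 1%N.
have [l l0 Lxkl] := lower_central_tor HA tA Lxk.
by exists (k * l)%N; [rewrite muln_gt0 k0 | rewrite expgnA].
Qed.

End LowerCentral.

(* Local nilpotency is what makes the elements of finite order a subgroup; the
   quotient of G by its torsion is formed through this proof. *)
Lemma torsion_normal : locally_nilpotent G -> is_normal_subgroup (torsion G).
Proof.
move=> lnG; split; [split; first by exists 1%N|].
  move=> x y tx ty; pose A := [set x; y].
  have tA : A `<=` torsion G by move=> _ [] ->.
  have sA := generated_subgroup A.
  apply: (generated_tor sA erefl tA).
    by apply: lnG; exists A => //; apply: finite_set2.
  by case: sA => _; apply; apply: sub_generated; [left | right].
by move=> x g [n n0 xn1]; exists n => //; rewrite -conjXg xn1 conj1g.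
Qed.

End TorsionNormal.

(* Main.v *)
Require Import Defs.
From mathcomp Require Import all_boot.
From mathcomp Require Import boolp classical_sets functions cardinality.

(* Aut G is closed in the permutations of a countable set, so it has the size of
   the continuum as soon as no finite subset s of G is rigid, i.e. as soon as some
   nontrivial automorphism fixes s pointwise: a binary tree of infinite products
   of automorphisms then gives 2^aleph0 of them.

   Suppose that s is rigid and generates F with F T = G, where T = tor G.  An
   automorphism of a normal subgroup M with M F = G that commutes with F and fixes
   M /\ F extends to G by the identity of F, so it is trivial.  Applied to
   conjugations, this gives C_G(F) = Z(G) and shows that F induces a finite group
   on T, of order n say; F /\ T is finite because F is finitely generated and
   nilpotent.  Fix a suitable multiple m of n.  If N is normal in G, N <= T, and
   T / N is finite of exponent dividing a power of m, then F N = G: otherwise G has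
   a normal subgroup of prime index p | m containing F, and a central element of
   order p in F gives a nontrivial automorphism.  Hence there is a smallest such
   subgroup R, and R = R' R^p for all primes p | m.

   If t in R and [t, F] <= Z(R), then the product of the n conjugates of t under F
   is central in G, so t^n lies in Z(R).  As every element of R /\ F is in R' R^n, it
   commutes with all t in R such that [t, H] <= Z(R) for a large enough finitely
   generated H >= F; conjugation by such t is then trivial on R, so t lies in Z(R).
   By local nilpotency, R is abelian.  Finally, the automorphism of R that
   raises to the power 1 + m on the m-part and inverts the m'-part is trivial,
   so R^m = 1.  As R = R^m, this means R = 1 and T <= F is finite. *)

Set Implicit Arguments.
Unset Strict Implicit.
Unset Printing Implicit Defensive.

Local Open Scope classical_set_scope.
Local Open Scope card_scope.
Local Open Scope group_scope.

(** * Subgroups and centralizers *)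

Section GroupBasics.
Variable G : groupType.
Implicit Types (H K M N : set G) (x y z : G) (s : seq G).

Lemma subgroup1 H : is_subgroup H -> H 1.
Proof. by case. Qed.

Lemma is_subgroupP H :
  H 1 -> (forall x y, H x -> H y -> H (x * y)) -> (forall x, H x -> H x^-1) ->
  is_subgroup H.
Proof. by move=> H1 HM HV; split=> // x y Hx Hy; apply: HM => //; apply: HV. Qed.

Lemma subgroupF H x y : is_subgroup H -> H x -> H y -> H (x / y).
Proof. by case=> _; apply. Qed.

Lemma subgroupJ H x y : is_subgroup H -> H x -> H y -> H (x ^ y).
Proof.
by move=> sH Hx Hy; rewrite conjgE; do ?apply: subgroupM => //; apply: subgroupV.
Qed.

Lemma subgroupR H x y : is_subgroup H -> H x -> H y -> H [~ x, y].
Proof.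
by move=> sH Hx Hy; rewrite commgEl; apply: subgroupM => //;
   [apply: subgroupV | apply: subgroupJ].
Qed.

Lemma subgroupMl H x y : is_subgroup H -> H x -> H (x * y) <-> H y.
Proof.
move=> sH Hx; split=> [Hxy|]; last exact: subgroupM.
by rewrite -[y](mulKg x); apply: subgroupM => //; apply: subgroupV.
Qed.

Lemma subgroupMr H x y : is_subgroup H -> H y -> H (x * y) <-> H x.
Proof.
move=> sH Hy; split=> [Hxy|Hx]; last exact: subgroupM.
by rewrite -[x](mulgK y); apply: subgroupF.
Qed.

Lemma subgroupVE H x : is_subgroup H -> H x^-1 <-> H x.
Proof. by move=> sH; split=> /(subgroupV sH); rewrite ?invgK. Qed.

Lemma subgroup_coprimeX H x m n : is_subgroup H -> coprime m n ->
  H (x ^+ m) -> H (x ^+ n) -> H x.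
Proof.
move=> sH; case: m => [|m] co_mn Hm Hn.
  by move: co_mn Hn; rewrite /coprime gcd0n => /eqP ->.
case: (egcdnP n (ltn0Sn m)) => u v; rewrite (eqP co_mn) => E _.
have := subgroupX u sH Hm; rewrite -expgnA mulnC E expgnDr expg1.
by move/(subgroupMl _ sH); apply; rewrite mulnC expgnA; apply: subgroupX.
Qed.

Lemma prime_order_expg (u : G) p k : u <> 1 -> u ^+ (p ^ k) = 1 ->
  exists i, u ^+ (p ^ i) <> 1 /\ (u ^+ (p ^ i)) ^+ p = 1.
Proof.
move=> u1; elim: k => [|k IHk] upk1; first by case: u1; rewrite -[LHS]expg1.
have [/IHk //|/eqP uk1] := eqVneq (u ^+ (p ^ k)) 1.
by exists k; rewrite -expgnA -expnSr.
Qed.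

Definition centralizer (A : set G) : set G :=
  [set x | forall y, A y -> commute x y].

Lemma centralizer_subgroup A : is_subgroup (centralizer A).
Proof.
apply: is_subgroupP => [y _|x y Cx Cy z Az|x Cx z Az].
- exact/commute_sym/commute1.
- by apply/commute_sym/commuteM; apply/commute_sym; [apply: Cx|apply: Cy].
- by apply/commute_sym/commuteV/commute_sym; apply: Cx.
Qed.

Definition gen s := generated [set x | x \in s].

Lemma gen_subgroup s : is_subgroup (gen s).
Proof. exact: generated_subgroup. Qed.

Lemma mem_gen s x : x \in s -> gen s x.
Proof. exact: sub_generated. Qed.

Lemma gen_min s H : is_subgroup H -> (forall x, x \in s -> H x) -> gen s `<=` H.
Proof. by move=> sH sub; apply: generated_min. Qed.

Lemma gen_sub s1 s2 : {subset s1 <= s2} -> gen s1 `<=` gen s2.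
Proof.
by move=> sub; apply: gen_min => [|x /sub]; [apply: gen_subgroup|apply: mem_gen].
Qed.

Lemma gen_nilpotent s : locally_nilpotent G -> is_nilpotent (gen s).
Proof. by apply; exists [set x | x \in s] => //; apply: finite_seq. Qed.

Lemma normal_subgroup N : is_normal_subgroup N -> is_subgroup N.
Proof. by case. Qed.

Lemma normalR N x g : is_normal_subgroup N -> N x -> N [~ x, g].
Proof.
move=> nN Nx; rewrite commgEl.
by apply: normalM => //; [apply: normalV | apply: normalJ].
Qed.

Lemma normalRl N x g : is_normal_subgroup N -> N x -> N [~ g, x].
Proof. by move=> nN Nx; rewrite -invgR; apply: (normalV nN); apply: normalR. Qed.

Lemma normalJE N x g : is_normal_subgroup N -> N (x ^ g) <-> N x.
Proof.
by move=> nN; split=> [/(normalJ nN g^-1)|]; [rewrite conjgK|apply: normalJ].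
Qed.

Lemma centralizer_normal N : is_normal_subgroup N ->
  is_normal_subgroup (centralizer N).
Proof.
move=> nN; split; first exact: centralizer_subgroup.
move=> x g Cx y Ny; have /(normalJE y g^-1 nN) Ny' := Ny.
by rewrite /commute -[y](conjgKV g) -!conjMg; congr (_ ^ _); apply: Cx.
Qed.

Lemma commute_conjg x y : commute x y <-> x ^ y = x.
Proof. by split=> [/commgP/conjg_fixP|/conjg_fixP/commgP]. Qed.

Lemma conj_centralizer M x y t : is_normal_subgroup M -> M t ->
  centralizer M (x^-1 * y) -> t ^ y = t ^ x.
Proof.
move=> nM Mt Cxy; rewrite -[y](mulVKg x) conjgM; apply/commute_conjg/commute_sym.
by apply: Cxy; apply: normalJ.
Qed.

Lemma commgMl x y z : [~ x * y, z] = [~ x, z] ^ y * [~ y, z].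
Proof. by rewrite !commgEl !conjgE !invgM -!mulgA !mulVKg. Qed.

Lemma commgMr x y z : [~ x, y * z] = [~ x, z] * [~ x, y] ^ z.
Proof. by rewrite !commgEl !conjgE !invgM -!mulgA !mulVKg. Qed.

Lemma commgVl x z : [~ x^-1, z] = ([~ x, z] ^ x^-1)^-1.
Proof.
by apply/esym/mulg1_eq; rewrite -commgMl mulgV comm1g.
Qed.

Lemma commgVr x z : [~ x, z^-1] = ([~ x, z] ^ z^-1)^-1.
Proof.
rewrite -[LHS]invgK; congr (_^-1); apply: mulg1_eq.
by rewrite -commgMr mulgV commg1.
Qed.

End GroupBasics.

(** * Nilpotent subgroups *)

Section Nilpotent.
Variable G : groupType.
Implicit Types (H K M N A : set G) (x y z : G) (s : seq G).

Lemma nilpotent_last_commutator H M A r : is_nilpotent H -> A 1 ->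
  (forall x h, M x -> H h -> M [~ x, h]) -> is_subgroup H -> M r -> H r ->
  ~ A r -> exists t, [/\ M t, H t, ~ A t & forall h, H h -> A [~ t, h]].
Proof.
move=> [c Lc] A1 MH sH Mr Hr nAr; apply: contrapT => no_t; apply: nAr.
have stepA t : M t -> H t -> (forall h, H h -> A [~ t, h]) -> A t.
  by move=> Mt Ht At; apply: contrapT => nAt; apply: no_t; exists t.
suff LA i : forall t, lower_central H (c - i) t -> M t -> A t.
  by apply: (LA c) => //; rewrite subnn.
elim: i => [|i IHi] t; first by rewrite subn0 Lc => ->.
case: (leqP c i) => [le_ci|lt_ic].
  move: (IHi t); have /eqP -> : (c - i == 0)%N by rewrite subn_eq0.
  by have /eqP -> : (c - i.+1 == 0)%N by rewrite subn_eq0 leqW.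
move=> Lt Mt; apply: stepA => // [|h Hh].
  exact: lower_central_sub Lt.
apply: IHi; last exact: MH.
by rewrite subnS in Lt; rewrite -(prednK (n := (c - i)%N)) ?subn_gt0 //;
   apply: lower_central_comm.
Qed.

Section CyclicExtension.
Variables (M T : set G) (x : G).
Hypotheses (sM : is_subgroup M) (sT : is_subgroup T).
Hypothesis T_tor : T `<=` torsion G.
Hypotheses (MJ : forall m, M m -> M (m ^ x)) (MJV : forall m, M m -> M (m ^ x^-1)).

(** [y] lies in the coset x^(a-b) M; the integer exponent is written as a difference of naturals. *)
Let E a b y := M ((x ^+ a)^-1 * (y * x ^+ b)).

Let MJX m a : M m -> M (m ^ (x ^+ a)).
Proof.
move=> Mm; elim: a => [|a IHa]; first by rewrite expg0 conjg1.
by rewrite expgSr conjgM; apply: MJ.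
Qed.

Let MJXV m a : M (m ^ (x ^+ a)) -> M m.
Proof.
elim: a m => [|a IHa] m; first by rewrite expg0 conjg1.
by rewrite expgS conjgM => /IHa /MJV; rewrite conjgK.
Qed.

Let E_M a b c d y z : E a b y -> E c d z -> E (a + c) (b + d) (y * z).
Proof.
move=> Ey Ez.
have := subgroupM sM (MJX c Ey) (MJX b Ez); rewrite /E.
suff -> : ((x ^+ a)^-1 * (y * x ^+ b)) ^ (x ^+ c) *
     ((x ^+ c)^-1 * (z * x ^+ d)) ^ (x ^+ b) =
     (x ^+ (a + c))^-1 * (y * z * x ^+ (b + d)) by [].
have comK w : x ^+ b * (x ^+ c * ((x ^+ b)^-1 * ((x ^+ c)^-1 * w))) = w.
  rewrite !mulgA -(mulgA _ (x ^+ b)^-1) -invgM -!expgnDr addnC mulgV.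
  by rewrite mul1g.
by rewrite (addnC b) !expgnDr !conjgE !invgM -!mulgA comK.
Qed.

Let E_V a b y : E a b y -> E b a y^-1.
Proof. by move=> /(subgroupV sM); rewrite /E !invgM invgK -mulgA. Qed.

Let E_gen y : generated (M `|` [set x]) y -> exists a b, E a b y.
Proof.
move: y; apply: generated_min.
  apply: is_subgroupP => [|y z [a [b Ey]] [c [d Ez]]|y [a [b Ey]]].
  - by exists 0%N, 0%N; rewrite /E !mulg1 invg1; apply: subgroup1.
  - by exists (a + c)%N, (b + d)%N; apply: E_M.
  - by exists b, a; apply: E_V.
move=> y [My|->].
  by exists 0%N, 0%N; rewrite /E !expg0 mulg1 invg1 mul1g.
by exists 1%N, 0%N; rewrite /E mulg1 mulVg; apply: subgroup1.
Qed.

Let E_X a b y q : E a b y -> E (a * q) (b * q) (y ^+ q).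
Proof.
move=> Ey; elim: q => [|q IHq].
  by rewrite !muln0 /E !expg0 mulg1 invg1 mulg1; apply: subgroup1.
by rewrite !mulnS expgS; apply: E_M.
Qed.

(** Raising [y] to a power [q] that kills it puts x^((b-a)q) into [M], which forces [a = b]. *)
Let infinite_case : (forall n, 0 < n -> ~ M (x ^+ n)) ->
  generated (M `|` [set x]) `&` T `<=` M `&` T.
Proof.
move=> nMx y [/E_gen [a [b Ey]] Ty]; split=> //.
have [q q_gt0 yq1] := T_tor Ty.
have := E_X q Ey; rewrite /E yq1 mul1g.
have [lt_ab|lt_ba|eq_ab] := ltngtP a b.
- rewrite -(subnKC (leq_mul (ltnW lt_ab) (leqnn q))) expgnDr mulKg -mulnBl.
  by move/nMx; rewrite muln_gt0 subn_gt0 lt_ab => /(_ q_gt0).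
- move/(subgroupV sM); rewrite invgM invgK.
  rewrite -(subnKC (leq_mul (ltnW lt_ba) (leqnn q))) expgnDr mulKg -mulnBl.
  by move/nMx; rewrite muln_gt0 subn_gt0 lt_ba => /(_ q_gt0).
by move: Ey; rewrite /E eq_ab -conjgE => /MJXV.
Qed.

Let finite_case n : 0 < n -> M (x ^+ n) -> forall y, generated (M `|` [set x]) y ->
  exists2 i, (i < n)%N & M ((x ^+ i)^-1 * y).
Proof.
move=> n_gt0 Mxn y /E_gen [a [b Ey]].
(* The summand [b * n.-1] stands for -b modulo [n]. *)
pose e := (a + b * n.-1)%N.
have MxnX j : M (x ^+ (j * n)) by rewrite mulnC expgnA; apply: subgroupX.
have Me : M ((x ^+ e)^-1 * y).
  have := subgroupF sM (MJX (b * n.-1) Ey) (MxnX b).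
  suff -> : ((x ^+ a)^-1 * (y * x ^+ b)) ^ x ^+ (b * n.-1) / x ^+ (b * n) =
    (x ^+ e)^-1 * y by [].
  rewrite -[in x ^+ (b * n)](prednK n_gt0) mulnS expgnDr /e expgnDr conjgE.
  by rewrite !invgM -!mulgA mulVKg mulgV mulg1.
exists (e %% n)%N; first by rewrite ltn_mod.
have := subgroupM sM (MxnX (e %/ n)%N) Me.
by rewrite {2}(divn_eq e n) addnC expgnDr invgM -mulgA mulVKg.
Qed.

(** If no positive power of [x] lies in [M], the extension has no new elements in [T]. Otherwise it
    is a union of finitely many cosets of [M], each of which meets [T] in the empty set or in a
    translate of M /\ T. *)
Lemma finite_torsion_cyclic_ext : finite_set (M `&` T) ->
  finite_set (generated (M `|` [set x]) `&` T).
Proof.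
move=> finM; have [[n n_gt0 Mxn]|nMx] := pselect (exists2 n, 0 < n & M (x ^+ n)).
  have fin : finite_set (\bigcup_(i in `I_n) ([set y | M ((x ^+ i)^-1 * y)] `&` T)).
    apply: bigcup_finite => [|i _]; first exact: finite_II.
    have [[y0 [/= My0 Ty0]]|no_y] := pselect (exists y, M ((x ^+ i)^-1 * y) /\ T y).
      apply: (sub_finite_set _ (finite_image ( *%g y0) finM)) => y [/= My Ty].
      exists (y0^-1 * y); last by rewrite mulVKg.
      split; last by apply: subgroupM => //; apply: subgroupV.
      by have := subgroupM sM (subgroupV sM My0) My; rewrite invgM invgK -mulgA mulVKg.
    apply: (@sub_finite_set _ _ set0) => [y MTy|]; last exact: finite_set0.
    by case: no_y; exists y.
  apply: (sub_finite_set _ fin) => y [/(finite_case n_gt0 Mxn) [i i_lt My] Ty].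
  by exists i.
apply: (sub_finite_set _ finM); apply: infinite_case => n n_gt0 Mxn.
by apply: nMx; exists n.
Qed.

End CyclicExtension.

(** Modulo term [i.+2], commutators of term [i] with [gen s] are multiplicative in each argument. So
    the commutators of generators of term [i] with members of [s] generate term [i.+1]. *)
Lemma lower_central_generators s i : exists l : seq G,
  (forall x, x \in l -> lower_central (gen s) i x) /\
  lower_central (gen s) i `<=`
    generated (lower_central (gen s) i.+1 `|` [set x | x \in l]).
Proof.
pose H := gen s; have sH : is_subgroup H := gen_subgroup s.
have sL := lower_central_subgroup sH.
elim: i => [|i [l [lL Ll]]].
  exists s; split=> [x|]; first exact: mem_gen.
  by apply: gen_min => [|x xs]; [apply: generated_subgroup|apply: sub_generated; right].
pose l' := [seq [~ x, y] | x <- l, y <- s]; exists l'.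
have l'L x : x \in l' -> lower_central H i.+1 x.
  case/allpairsP => -[y z] /= [yl zs ->].
  by apply: lower_central_comm => //; [apply: lL | apply: mem_gen].
split=> //; set M := generated _; have sM : is_subgroup M := generated_subgroup _.
have LM x : lower_central H i.+2 x -> M x by move=> Lx; apply: sub_generated; left.
have ML : M `<=` lower_central H i.+1.
  by apply: generated_min => // x [/(lower_central_le sH)//|/l'L].
have MJ x h : lower_central H i.+1 x -> H h -> M x -> M (x ^ h).
  move=> Lx Hh Mx; rewrite -[x ^ h](mulVKg x) -commgEl.
  by apply: (subgroupM sM Mx); apply: LM; apply: lower_central_comm.
have lM x h0 : x \in l -> H h0 -> M [~ x, h0].
  move=> xl; have Lx := lL x xl.
  suff sK : is_subgroup (H `&` [set h | M [~ x, h]]).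
    move=> /(gen_min sK) [] // k ks; split; first exact: mem_gen.
    by apply: sub_generated; right; apply/allpairsP; exists (x, k).
  apply: is_subgroupP => [|h k [Hh Mh] [Hk Mk]|h [Hh Mh]].
  - by split; [apply: (subgroup1 sH)|rewrite /= commg1; apply: (subgroup1 sM)].
  - split; first exact: (subgroupM sH).
    rewrite /= commgMr; apply: (subgroupM sM) => //; apply: MJ => //.
    exact: lower_central_comm.
  - split; first exact: (subgroupV sH).
    rewrite /= commgVr; apply: (subgroupV sM) => //; apply: MJ => //.
      exact: lower_central_comm.
    exact: (subgroupV sH).
suff sK : is_subgroup
    (lower_central H i `&` [set x | forall h, H h -> M [~ x, h]]).
  apply: generated_min => // _ [x [h [Lx Hh ->]]].
  suff lK : lower_central H i.+1 `|` [set x | x \in l] `<=`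
      lower_central H i `&` [set x | forall h, H h -> M [~ x, h]].
    by case: (generated_min sK lK (Ll x Lx)) => _; apply.
  move=> y [Ly|yl]; last by split; [apply: lL|move=> k; apply: lM].
  split; first exact: (lower_central_le sH).
  by move=> k Hk; apply: LM; apply: lower_central_comm.
apply: is_subgroupP => [|x y [Lx Mx] [Ly My]|x [Lx Mx]].
- split=> [|h _]; first exact: (subgroup1 (sL i)).
  by rewrite comm1g; apply: (subgroup1 sM).
- split=> [|h Hh]; first exact: (subgroupM (sL i)).
  rewrite commgMl; apply: (subgroupM sM); last exact: My.
  apply: MJ; [exact: lower_central_comm| |exact: Mx].
  exact: lower_central_sub Ly.
- split=> [|h Hh]; first exact: (subgroupV (sL i)).
  rewrite commgVl; apply: (subgroupV sM) => //; apply: MJ; last exact: Mx.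
    exact: lower_central_comm.
  by apply: (subgroupV sH) => //; apply: lower_central_sub Lx.
Qed.

(** Climb the lower central series from its trivial end. Each term arises from the next one by
    adjoining finitely many elements one at a time; every intermediate subgroup contains the next
    term, so the new element normalizes it. *)
Lemma finite_torsion_gen s T : is_nilpotent (gen s) -> is_subgroup T ->
  T `<=` torsion G -> finite_set (gen s `&` T).
Proof.
move=> [c Lc] sT T_tor; have sH := gen_subgroup s.
have sL := lower_central_subgroup sH.
suff fin i : finite_set (lower_central (gen s) (c - i) `&` T).
  by have := fin c; rewrite subnn.
elim: i => [|i IHi].
  by rewrite subn0 Lc; apply: (@sub_finite_set _ _ [set 1]) => // x [].
case: (leqP c i) => [le_ci|lt_ic].
  have /eqP -> : (c - i.+1 == 0)%N by rewrite subn_eq0 leqW.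
  by have /eqP <- : (c - i == 0)%N by rewrite subn_eq0.
move: IHi; rewrite -(prednK (n := (c - i)%N)) ?subn_gt0 // -subnS.
set j := (c - i.+1)%N => finL; have [l [lL Ll]] := lower_central_generators s j.
suff: finite_set (generated (lower_central (gen s) j.+1 `|` [set x | x \in l]) `&` T).
  by apply: sub_finite_set => x [/Ll Lx Tx].
elim: l {Ll} lL => [_|x l IHl lL].
  apply: sub_finite_set finL => x [Lx Tx]; split=> //; move: x Lx {Tx}.
  by apply: generated_min => // x [].
have {}IHl := IHl (fun y yl => lL y (mem_behead (s := x :: l) yl)).
set M := generated _ in IHl; have sM : is_subgroup M := generated_subgroup _.
have Lx : lower_central (gen s) j x by apply: lL; rewrite mem_head.
have ML : M `<=` lower_central (gen s) j.
  apply: generated_min => // y [/(lower_central_le sH)//|yl].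
  by apply: lL; rewrite inE yl orbT.
have MJ y m : lower_central (gen s) j y -> M m -> M (m ^ y).
  move=> Ly Mm; rewrite -[m ^ y](mulVKg m) -commgEl; apply: (subgroupM sM) => //.
  apply: sub_generated; left; apply: lower_central_comm; first exact: ML.
  exact: lower_central_sub Ly.
have sub : generated (lower_central (gen s) j.+1 `|` [set y | y \in x :: l]) `<=`
    generated (M `|` [set x]).
  apply: generated_min; first exact: generated_subgroup.
  move=> y [Ly|]; first by apply: sub_generated; left; apply: sub_generated; left.
  rewrite /= inE => /orP[/eqP ->|yl]; apply: sub_generated; first by right.
  by left; apply: sub_generated; right.
apply: sub_finite_set
  (finite_torsion_cyclic_ext sM sT T_tor (x := x) _ _ IHl) => [y [My Ty]|m|m].
- by split=> //; apply: sub.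
- exact: MJ.
- by apply: MJ; apply: subgroupV.
Qed.

(** If the centre of [H] had no element of order [p], no term of the lower central series would have
    nontrivial elements of [p]-power order. The induction starts at the trivial end: such an element
    is shown to be central, and one of its powers has order [p]. *)
Lemma nilpotent_central_order H p x : is_nilpotent H -> is_subgroup H ->
  is_normal_subgroup (torsion G) -> prime p -> H x -> x ^+ p = 1 -> x <> 1 ->
  exists z, [/\ H z, z ^+ p = 1, z <> 1 & forall h, H h -> commute z h].
Proof.
move=> [c Lc] sH nT p_pr Hx xp1 x1; apply: contrapT => no_z.
have sL := lower_central_subgroup sH.
suff L1 i : forall u k, lower_central H (c - i) u -> u ^+ (p ^ k) = 1 -> u = 1.
  by apply: x1; apply: (L1 c x 1%N); rewrite ?subnn.
elim: i => [|i IHi] u k; first by rewrite subn0 Lc => ->.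
case: (leqP c i) => [le_ci|lt_ic].
  have /eqP -> : (c - i.+1 == 0)%N by rewrite subn_eq0 leqW.
  by move: (IHi u k); have /eqP -> : (c - i == 0)%N by rewrite subn_eq0.
move: IHi; rewrite -(prednK (n := (c - i)%N)) ?subn_gt0 // -subnS.
have lt_jc : (c - i.+1 < c)%N by rewrite ltn_subrL (leq_ltn_trans _ lt_ic).
move: (c - i.+1)%N lt_jc => j lt_jc IHj Lu upk1.
have Hu := lower_central_sub sH Lu.
have u_central h : H h -> commute u h.
  move=> Hh; apply/commgP/eqP; set v := [~ u, h].
  have Hv : H v := subgroupR sH Hu Hh.
  suff Lv m : lower_central H (j.+1 + m) v.
    by have := Lv (c - j.+1)%N; rewrite subnKC // Lc.
  have vN : lower_central H j.+1 v by apply: lower_central_comm.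
  have [N N_gt0 vN1] : torsion G v.
    by apply: normalR => //; exists (p ^ k)%N; rewrite // expn_gt0 prime_gt0.
  (* This power is a [p]-element of the next term, hence trivial; so the order of [v] is prime to
     [p]. *)
  have vp'1 : v ^+ (N`_p^') = 1.
    apply: (IHj _ (logn p N)); first exact: (subgroupX _ (sL j.+1)).
    by rewrite -expgnA -p_part mulnC partnC.
  (* Modulo the following term [u] commutes with [v], and [u * v] is [u ^ h], so [v ^+ (p ^ k)] lies
     in that term; since the order of [v] is prime to [p], so does [v]. *)
  elim: m => [|m IHm]; first by rewrite addn0.
  rewrite addnS; set i' := (j.+1 + m)%N in IHm *.
  apply: (@subgroup_coprimeX _ _ _ (N`_p^') (p ^ k) (sL _)); first 1 last.
  - by rewrite vp'1; apply: (subgroup1 (sL i'.+1)).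
  - have Euv q : lower_central H i'.+1 ((u ^+ q * v ^+ q)^-1 * (u * v) ^+ q).
      clearbody v; elim: q => [|q IHq].
        by rewrite !expg0 !mulg1 invg1; apply: (subgroup1 (sL i'.+1)).
      have Lvq := subgroupX q (sL _) IHm.
      have Huv := subgroupM sH Hu Hv.
      have := subgroupM (sL i'.+1)
        (lower_centralJ sH (lower_central_comm Lvq Hu) Hv) (lower_centralJ sH IHq Huv).
      congr (lower_central _ _ _); rewrite !expgSr commgEl !conjgE !invgM.
      by rewrite -!mulgA !mulVKg.
    have := Euv (p ^ k)%N; rewrite upk1 mul1g.
    have -> : (u * v) ^+ (p ^ k) = 1.
      by rewrite mulVKg -conjXg upk1 conj1g.
    by rewrite mulg1 => /(subgroupV (sL i'.+1)); rewrite invgK.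
  - rewrite coprime_sym; apply: (@pnat_coprime p); last exact: part_pnat.
    by rewrite pnatX pnat_id.
apply: contrapT => u1; apply: no_z.
have [e [ue uep]] := prime_order_expg u1 upk1.
exists (u ^+ (p ^ e)); split=> // [|h Hh]; first exact: (subgroupX _ sH).
by apply/commute_sym/commuteX/commute_sym/u_central.
Qed.

End Nilpotent.

(** * Subgroups of prime index *)

Definition eq_mod (G : groupType) (X : set G) (x y : G) := X (x^-1 * y).

Lemma eq_mod_trans (G : groupType) (X : set G) y x z : is_subgroup X ->
  eq_mod X x y -> eq_mod X y z -> eq_mod X x z.
Proof.
by move=> sX /(subgroupM sX)/[apply]; rewrite -mulgA mulVKg.
Qed.

Lemma eq_mod_sym (G : groupType) (X : set G) x y : is_subgroup X ->
  eq_mod X x y -> eq_mod X y x.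
Proof. by move=> sX /(subgroupV sX); rewrite /eq_mod invgM invgK. Qed.

Section AbelianQuotient.
Variables (G : groupType) (L D : set G).
Hypotheses (sL : is_subgroup L) (sD : is_subgroup D) (DL : D `<=` L).
Hypothesis DR : forall x y, L x -> L y -> D [~ x, y].
Implicit Types (x y z : G) (X : set G).

Let D_J d x : D d -> L x -> D (d ^ x).
Proof.
move=> Dd Lx; rewrite -[d ^ x](mulVKg d) -commgEl.
by apply: (subgroupM sD Dd); apply: DR => //; apply: DL.
Qed.

Lemma eq_modM x y z t : L z -> eq_mod D x y -> eq_mod D z t -> eq_mod D (x * z) (y * t).
Proof.
move=> Lz Dxy Dzt; rewrite /eq_mod.
by have := subgroupM sD (D_J Dxy Lz) Dzt; rewrite conjgE !invgM -!mulgA mulVKg.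
Qed.

Lemma eq_modV x y : L x -> eq_mod D x y -> eq_mod D x^-1 y^-1.
Proof.
move=> Lx /(subgroupV sD)/D_J/(_ (subgroupV sL Lx)); rewrite /eq_mod.
by rewrite conjgE !invgM invgK -!mulgA mulgV mulg1.
Qed.

Lemma eq_modX x y k : L x -> eq_mod D x y -> eq_mod D (x ^+ k) (y ^+ k).
Proof.
move=> Lx Dxy; elim: k => [|k IHk].
  by rewrite /eq_mod !expg0 mulg1 invg1; apply: subgroup1.
have := subgroupM sD (D_J IHk Lx) Dxy; congr D.
by rewrite !expgSr conjgE invgM -!mulgA mulVKg.
Qed.

Lemma eq_mod_expgM x y k : L x -> L y -> eq_mod D (x ^+ k * y ^+ k) ((x * y) ^+ k).
Proof.
move=> Lx Ly; elim: k => [|k IHk].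
  by rewrite /eq_mod !expg0 !mulg1 invg1; apply: subgroup1.
have Lyk := subgroupX k sL Ly.
have := subgroupM sD (D_J (DR Lyk Lx) Ly) (D_J IHk (subgroupM sL Lx Ly)).
congr D; rewrite !expgSr commgEl !conjgE !invgM.
by rewrite -!mulgA !mulVKg.
Qed.

Lemma abelian_divisible_primes m :
  (forall p, prime p -> p %| m ->
    forall x, L x -> exists2 y, L y & D ((y ^+ p)^-1 * x)) ->
  forall n, 0 < n -> {subset \pi(n) <= \pi(m)} ->
  forall x, L x -> exists2 y, L y & D ((y ^+ n)^-1 * x).
Proof.
move=> divp; elim/ltn_ind => n IHn n_gt0 pi_n x Lx.
case: (ltngtP n 1) => [|n_gt1|->]; first by rewrite ltnNge n_gt0.
  have [p p_pr p_n] := pdivP n_gt1.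
  have n'_gt0 : 0 < n %/ p by rewrite divn_gt0 ?(prime_gt0 p_pr) //; apply: dvdn_leq.
  have [||y Ly Dyx] := IHn (n %/ p)%N _ n'_gt0 _ x Lx.
  - by rewrite ltn_Pdiv ?(prime_gt1 p_pr).
  - move=> q; rewrite mem_primes => /and3P[q_pr _ q_n]; apply: pi_n.
    by rewrite mem_primes q_pr n_gt0 (dvdn_trans q_n) // dvdn_div.
  have [|z Lz Dzy] := divp p p_pr _ y Ly.
    have: p \in \pi(m) by apply: pi_n; rewrite mem_primes p_pr n_gt0.
    by rewrite mem_primes => /and3P[].
  exists z => //; apply: eq_mod_trans Dyx => //.
  have -> : z ^+ n = z ^+ p ^+ (n %/ p) by rewrite -expgnA mulnC divnK.
  by apply: eq_modX; first exact: subgroupX.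
by exists x; rewrite // expg1 mulVg; apply: subgroup1.
Qed.

End AbelianQuotient.

Section Hyperplane.
Variables (G : groupType) (L D : set G).
Hypotheses (sL : is_subgroup L) (sD : is_subgroup D) (DL : D `<=` L).
Hypothesis DR : forall x y, L x -> L y -> D [~ x, y].
Variables (p : nat) (x : G).
Hypotheses (p_pr : prime p) (Lx : L x).
Hypothesis x_ndiv : forall y, L y -> ~ D ((y ^+ p)^-1 * x).

(** L / Q is the abelian group L / D modulo its [p]-th powers, a vector space over the field with
    [p] elements. The subgroup sought is a hyperplane that misses [x]. *)
Let Q := [set w | L w /\ exists2 y, L y & D ((y ^+ p)^-1 * w)].

Let sQ : is_subgroup Q.
Proof.
apply: is_subgroupP => [|w z [Lw [y Ly Dy]] [Lz [t Lt Dt]]|w [Lw [y Ly Dy]]].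
- split; first exact: subgroup1.
  exists 1; first exact: subgroup1.
  by rewrite expg1n mulg1 invg1; apply: subgroup1.
- split; first exact: subgroupM.
  exists (y * t); first exact: subgroupM.
  apply: (eq_mod_trans (y := y ^+ p * t ^+ p) sD).
    by apply: (eq_mod_sym sD); apply: (eq_mod_expgM sL).
  by apply: (eq_modM sD DL DR) Dy Dt; apply: (subgroupX _ sL).
- split; first exact: subgroupV.
  exists y^-1; first exact: subgroupV.
  by rewrite expVgn; apply: (eq_modV sL sD DL DR) Dy; apply: (subgroupX _ sL).
Qed.

Lemma exists_index_p_subgroup : exists X,
  [/\ is_subgroup X, D `<=` X /\ X `<=` L, ~ X x,
      (forall y, L y -> X (y ^+ p)) &
      (forall y, L y -> exists2 i, (i < p)%N & X ((x ^+ i)^-1 * y))].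
Proof.
have nQx : ~ Q x by case=> _ [y Ly]; apply: x_ndiv.
have DQ : D `<=` Q.
  move=> d Dd; split; first exact: DL.
  by exists 1; [apply: subgroup1|rewrite expg1n invg1 mul1g].
(* Taking the union with [Q] admits the empty set as a candidate, which is the union of the empty
   chain. *)
pose P X := is_subgroup (X `|` Q) /\ X `|` Q `<=` L `\ x.
have sF (F : set (set G)) : F `<=` P -> total_on F subset -> P (\bigcup_(X in F) X).
  move=> FP totF; have UE y : (\bigcup_(X in F) X `|` Q) y <->
      Q y \/ exists2 X, F X & (X `|` Q) y.
    split=> [[[X FX Xy]|Qy]|[Qy|[X FX [Xy|Qy]]]]; try by [right|left].
    - by right; exists X => //; left.
    - by left; exists X.
  split; last first.
    move=> y /UE[Qy|[X FX]]; last by case: (FP _ FX) => _; apply.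
    by split=> [|yx]; [case: Qy|apply: nQx; rewrite -yx].
  have QF X y : Q y -> (X `|` Q) y by right.
  have common y z : (\bigcup_(X in F) X `|` Q) y -> (\bigcup_(X in F) X `|` Q) z ->
      (Q y /\ Q z) \/ exists X, [/\ F X, (X `|` Q) y & (X `|` Q) z].
    move=> /UE[Qy|[X FX Xy]] /UE[Qz|[Y FY Yz]]; first by left.
    - by right; exists Y; split=> //; apply: QF.
    - by right; exists X; split=> //; apply: QF.
    right; have [XY|YX] := totF _ _ FX FY; [exists Y|exists X]; split=> //.
      by case: Xy => [/XY|]; [left|right].
    by case: Yz => [/YX|]; [left|right].
  split=> [|y z /common/[apply]]; first by right; apply: subgroup1.
  case=> [[Qy Qz]|[X [FX Xy Xz]]]; apply/UE; first by left; apply: subgroupF.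
  by right; exists X => //; case: (FP _ FX) => sX _; apply: subgroupF.
have [X0 [[sX XL] maxX]] := Zorn_bigcup sF.
set X := X0 `|` Q in sX XL; exists X.
have XR y z : L y -> L z -> X [~ y, z] by move=> Ly Lz; right; apply/DQ/DR.
have XX y : L y -> X (y ^+ p).
  move=> Ly; right; split; first exact: subgroupX.
  by exists y => //; rewrite mulVg; apply: subgroup1.
have XL' : X `<=` L by move=> y /XL[].
have nXx : ~ X x by move/XL => -[_]; apply.
split=> // [|y Ly]; first by split=> // y Dy; right; apply: DQ.
have [Xy|nXy] := pselect (X y).
  by exists 0%N; rewrite ?prime_gt0 // expg0 invg1 mul1g.
have XJ w z : X w -> L z -> X (w ^ z).
  move=> Xw Lz; rewrite -[w ^ z](mulVKg w) -commgEl.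
  by apply: (subgroupM sX Xw); apply: XR => //; apply: XL'.
pose Y := generated (X `|` [set y]).
have YE : Y `<=` [set w | L w /\ exists i, X ((y ^+ i)^-1 * w)].
  apply: generated_min => [|w [Xw|->]]; last first.
  - by split=> //; exists 1%N; rewrite mulVg; apply: subgroup1.
  - by split; [apply: XL'|exists 0%N; rewrite expg0 invg1 mul1g].
  apply: is_subgroupP => [|w z [Lw [i Xw]] [Lz [j Xz]]|w [Lw [i Xw]]].
  - split; [exact: subgroup1|exists 0%N].
    by rewrite expg0 invg1 mul1g; apply: subgroup1.
  - split; [exact: subgroupM|exists (i + j)%N; rewrite expgnDr].
    exact: (eq_modM sX XL' XR (subgroupX j sL Ly) Xw Xz).
  (* As [y ^+ p] lies in [X], multiplying the exponent by [p.-1] inverts the power modulo [X]. *)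
  - split; [exact: subgroupV|exists (i * p.-1)%N].
    apply: (eq_mod_trans (y := (y ^+ i)^-1) sX).
      rewrite /eq_mod -invgM -expgnDr -mulnS prednK ?prime_gt0 //.
      by rewrite expgnA; apply: (subgroupV sX); apply: XX; apply: (subgroupX _ sL).
    by apply: (eq_modV sL sX XL' XR) Xw; apply: (subgroupX _ sL).
(* By maximality of [X], adjoining [y] captures [x]. *)
have Yx : Y x.
  apply: contrapT => nYx; apply: (maxX Y).
    split; last first.
      by move=> XY; apply: nXy; left; apply: XY; apply: sub_generated; right.
    by move=> w Xw; apply: sub_generated; left; left.
  have YU : Y `|` Q = Y.
    by apply/setUidPl => w Qw; apply: sub_generated; left; right.
  split; rewrite YU; first exact: generated_subgroup.
  move=> w Yw; split; first by case: (YE w Yw).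
  by move=> /= wx; apply: nYx; rewrite -wx.
have [_ [i Xi]] := YE x Yx.
have p'i : ~~ (p %| i).
  apply/negP => /dvdnP[k Ei]; apply: nXx.
  rewrite -[x](mulVKg (y ^+ i)); apply: (subgroupM sX) Xi.
  by rewrite Ei expgnA; apply: XX; apply: (subgroupX _ sL).
have i_gt0 : 0 < i by case: (i) p'i => //; rewrite dvdn0.
(* [u] inverts [i] modulo [p]; since [x] is congruent to [y ^+ i], [x ^+ u] is congruent to [y]. *)
have [u v Euv _] := egcdnP p i_gt0.
have /eqP gcd1 : coprime i p by rewrite coprime_sym prime_coprime.
rewrite gcd1 in Euv; exists (u %% p)%N; first by rewrite ltn_mod prime_gt0.
apply: (eq_mod_trans (y := x ^+ u) sX).
  rewrite /eq_mod {2}(divn_eq u p) addnC expgnDr mulKg expgnA.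
  by apply: XX; apply: (subgroupX _ sL).
apply: (eq_mod_trans (y := y ^+ (u * i)) sX); last first.
  apply: (eq_mod_sym sX); rewrite /eq_mod Euv addn1 expgS mulKg expgnA.
  by apply: XX; apply: (subgroupX _ sL).
apply: (eq_mod_sym sX); rewrite mulnC expgnA.
by apply: (eq_modX sX XL' XR) => //; apply: (subgroupX _ sL).
Qed.

End Hyperplane.

(** * Rigid finite sets *)

Lemma inj_surj_bijective (T U : Type) (f : T -> U) :
  injective f -> (forall y, exists x, f x = y) -> bijective f.
Proof.
move=> f_inj /choice[g gK]; exists g => // x.
by apply: f_inj; rewrite gK.
Qed.

Definition rigid (G : groupType) (s : seq G) :=
  forall f, automorphisms G f -> {in s, f =1 id} -> f =1 id.

Lemma rigid_sub (G : groupType) (s1 s2 : seq G) :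
  {subset s1 <= s2} -> rigid s1 -> rigid s2.
Proof. by move=> sub rig f autf fs; apply: rig => // x /sub; apply: fs. Qed.

Section Rigid.
Variables (G : groupType) (s : seq G).
Hypothesis rig : rigid s.
Let F := gen s.
Let sF : is_subgroup F := gen_subgroup s.
Implicit Types (M : set G) (x y z g : G).

Lemma rigid_gen f : automorphisms G f -> (forall x, F x -> f x = x) -> f =1 id.
Proof. by move=> autf fF; apply: rig => // x xs; apply: fF; apply: mem_gen. Qed.

Section Extension.
Variable M : set G.
Hypotheses (nM : is_normal_subgroup M).
Hypothesis FM : forall g, exists2 f, F f & M (f^-1 * g).

Let FM2 g : exists f m, [/\ F f, M m & g = f * m].
Proof.
by have [f Ff Mg] := FM g; exists f, (f^-1 * g); split; rewrite // mulVKg.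
Qed.

(** The extension sends [f * m] to [f * al m]. It is well defined because [al] is the identity on F
    /\ M, and multiplicative because [al] commutes with conjugation by [F]. *)
Lemma rigid_extension (al : G -> G) :
  (forall m, M m -> M (al m)) ->
  (forall m m', M m -> M m' -> al m = al m' -> m = m') ->
  (forall m, M m -> exists2 m', M m' & al m' = m) ->
  (forall m m', M m -> M m' -> al (m * m') = al m * al m') ->
  (forall m f, M m -> F f -> al (m ^ f) = al m ^ f) ->
  (forall m, M m -> F m -> al m = m) ->
  forall m, M m -> al m = m.
Proof.
move=> alM al_inj al_surj al_mul al_conj al_id.
have sM := normal_subgroup nM.
have /choice[rho rhoP] g : exists f, F f /\ M (f^-1 * g).
  by have [f Ff Mf] := FM g; exists f.
pose be g := rho g * al ((rho g)^-1 * g).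
have beE f m : F f -> M m -> be (f * m) = f * al m.
  move=> Ff Mm; rewrite /be; have [Fr Mr] := rhoP (f * m).
  set r := rho _ in Fr Mr *.
  have Fd : F (r^-1 * f) by apply: (subgroupM sF) => //; apply: (subgroupV sF).
  have Md : M (r^-1 * f).
    by have := subgroupF sM Mr Mm; rewrite -mulgA mulgK.
  by rewrite mulgA al_mul // (al_id _ Md Fd) !mulgA mulgV mul1g.
suff be_id : be =1 id.
  move=> m Mm; have := be_id (1 * m).
  by rewrite beE //= ?mul1g //; apply: (subgroup1 sF).
apply: rigid_gen => [|f Ff]; last first.
  have M1 := subgroup1 sM; rewrite -[f in LHS]mulg1 beE // al_id ?mulg1 //.
  exact: (subgroup1 sF).
split.
  apply: inj_surj_bijective => [x y|y].
    have [[f [m [Ff Mm ->]]] [f' [m' [Ff' Mm' ->]]]] := (FM2 x, FM2 y).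
    rewrite !beE // => E.
    have Ed : f'^-1 * f = al m' / al m.
      by apply: (mulIg (al m)); rewrite mulgVK -mulgA E mulKg.
    have Md : M (f'^-1 * f) by rewrite Ed; apply: subgroupF => //; apply: alM.
    have Fd : F (f'^-1 * f) by apply: (subgroupM sF) => //; apply: (subgroupV sF).
    have -> : m' = f'^-1 * f * m.
      apply: al_inj => //; first exact: subgroupM.
      by rewrite al_mul // (al_id _ Md Fd) Ed mulgVK.
    by rewrite -mulgA mulVKg.
  have [f [m [Ff Mm ->]]] := FM2 y; have [m' Mm' <-] := al_surj m Mm.
  by exists (f * m'); rewrite beE.
move=> x y; have [[f [m [Ff Mm ->]]] [f' [m' [Ff' Mm' ->]]]] := (FM2 x, FM2 y).
have -> : f * m * (f' * m') = (f * f') * (m ^ f' * m').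
  by rewrite conjgE -!mulgA !mulVKg.
have Mmf := normalJ nM f' Mm.
rewrite !beE //; [|exact: (subgroupM sF)|exact: subgroupM].
by rewrite al_mul // al_conj // conjgE -!mulgA !mulVKg.
Qed.

(** Conjugation by [y] commutes on [M] with conjugation by each [f] in [F], because [y, f]
    centralizes [M]. *)
Lemma rigid_conj y : (forall f, F f -> centralizer M [~ y, f]) ->
  (forall m, M m -> F m -> commute m y) -> centralizer M y.
Proof.
move=> yF yM m Mm; apply/commute_sym/commute_conjg.
apply: (@rigid_extension (fun m => m ^ y)) => //
  {m Mm} [m Mm|m m' _ _|m Mm|m m' _ _|m f Mm Ff|m Mm Fm].
- exact: normalJ.
- exact: conjg_inj.
- by exists (m ^ y^-1); [apply: normalJ | rewrite conjgKV].
- exact: conjMg.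
- rewrite -!conjgM; apply/esym/(conj_centralizer nM) => //.
  by have := yF _ Ff; rewrite commgEl conjgE invgM -!mulgA.
- by apply/commute_conjg/yM.
Qed.

End Extension.
End Rigid.

Lemma perm_prod_commute (G : groupType) (s1 s2 : seq G) : perm_eq s1 s2 ->
  {in s1 &, forall x y, commute x y} -> \prod_(x <- s1) x = \prod_(x <- s2) x.
Proof.
elim: s1 s2 => [|y s1 IHs] s2; first by rewrite perm_sym => /perm_nilP ->.
move=> eq_s com; have ys2 : y \in s2 by rewrite -(perm_mem eq_s) mem_head.
case/splitPr: ys2 eq_s => a b eq_s.
have eq_ab : perm_eq s1 (a ++ b)
  by rewrite -(perm_cons y) (perm_trans eq_s) // -(cat1s y b) perm_catCA.
rewrite big_cons (IHs _ eq_ab) => [|u v us vs]; last first.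
  by apply: com; rewrite inE (us, vs) orbT.
rewrite !big_cat big_cons /= !mulgA; congr (_ * _).
rewrite big_seq; apply: (@commute_prod _ _ a (mem a) id y) => z za.
apply: com; first exact: mem_head.
by rewrite (perm_mem eq_s) mem_cat; apply/orP; left.
Qed.

(** * The action of F on the torsion subgroup *)

Section RigidTorsion.
Variables (G : groupType) (s : seq G).
Hypotheses (lnG : locally_nilpotent G) (rig : rigid s).
Let F := gen s.
Let T := torsion G.
Hypothesis FT : forall g, exists2 f, F f & T (f^-1 * g).
Let sF : is_subgroup F := gen_subgroup s.
Let nT : is_normal_subgroup T := torsion_normal lnG.
Let sT : is_subgroup T := normal_subgroup nT.
Implicit Types (M : set G) (x y z g : G).

(** Conjugation by [x] commutes with the action of [F] and fixes F /\ T, so it is trivial on [T];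
    and F T = G. *)
Lemma rigid_fixed_central x : (forall f, F f -> commute x f) -> forall g, commute x g.
Proof.
move=> xF g; have [f Ff Tg] := FT g.
have xT : centralizer T x.
  apply: (rigid_conj rig nT FT) => [f' Ff'|m _ Fm]; last exact/commute_sym/xF.
  by have /commgP/eqP -> := xF _ Ff' => m _; apply/commute_sym/commute1.
by rewrite -(mulVKg f g); apply: commuteM; [apply: xF|apply: xT].
Qed.

Lemma rigid_finite_torsion : finite_set (F `&` T).
Proof. by apply: finite_torsion_gen => //; apply: gen_nilpotent. Qed.

(** The action of [F] on [T] is thus determined by its action on the finite group F /\ T. A
    counterexample would yield [t] in [F] that centralizes F /\ T but not [T], and whose commutators
    with [F] centralize [T]; this contradicts [rigid_conj]. *)
Lemma rigid_centralizer_torsion y : F y ->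
  (forall k, F k -> T k -> commute y k) -> centralizer T y.
Proof.
move=> Fy yK; apply: contrapT => nTy.
pose M := [set y | F y /\ forall k, F k -> T k -> commute y k].
have [|||t [[Ft tK] _ nTt tF]] :=
    nilpotent_last_commutator (M := M) (A := centralizer T) (gen_nilpotent s lnG)
      _ _ sF _ Fy nTy.
- by apply: subgroup1; apply: centralizer_subgroup.
- move=> x h [Fx xK] Fh; split=> [|k Fk Tk]; first exact: (subgroupR sF).
  rewrite commgEl; apply/commute_sym/commuteM; first exact/commuteV/commute_sym/xK.
  rewrite /commute -[k](conjgKV h) -!conjMg; congr (_ ^ _); apply/esym/xK.
    by apply: (subgroupJ sF) => //; apply: (subgroupV sF).
  exact: (normalJ nT).
- by [].
apply: nTt; apply: (rigid_conj rig nT FT) => // m Tm Fm.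
exact/commute_sym/tK.
Qed.

(** [r] represents the group that [F] induces on [T], which is finite because it acts faithfully on
    F /\ T. *)
Lemma rigid_transversal : exists r : seq G,
  [/\ uniq r, (forall x, x \in r -> F x),
      (forall f, F f -> exists2 x, x \in r & centralizer T (x^-1 * f)) &
      {in r &, forall x y, centralizer T (x^-1 * y) -> x = y}].
Proof.
have /finite_seqP[ks Kks] := rigid_finite_torsion.
have ksP k : k \in ks <-> (F `&` T) k by rewrite Kks.
(* [phi f] is the permutation of [ks] under conjugation by [f], stored as a table of indices. *)
pose phi f := [ffun i : 'I_(size ks) => inord (index (ks`_i ^ f) ks) : 'I_(size ks).+1].
have phiP f g : F f -> F g -> phi f = phi g <-> centralizer T (f^-1 * g).
  move=> Ff Fg; have Ffg : F (f^-1 * g).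
    by apply: (subgroupM sF) => //; apply: (subgroupV sF).
  have Kf k h : k \in ks -> F h -> k ^ h \in ks.
    move=> /ksP[Fk Tk] Fh; apply/ksP; split; last exact: (normalJ nT).
    exact: (subgroupJ sF).
  split=> [/ffunP eq_fg|Cfg].
    apply: rigid_centralizer_torsion => // k Fk Tk.
    have k_ks : k ^ f^-1 \in ks by apply: Kf; [apply/ksP|apply: (subgroupV sF)].
    have i_lt : (index (k ^ f^-1)%g ks < size ks)%N by rewrite index_mem.
    have := eq_fg (Ordinal i_lt); rewrite !ffunE /= nth_index // conjgKV.
    move/(congr1 val).
    rewrite /= !inordK ?ltnS ?index_size // => eq_ind.
    have eq_k : k = (k ^ f^-1) ^ g.
      rewrite -[LHS](nth_index 1 (s := ks)) ?eq_ind ?nth_index //; last exact/ksP.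
      exact: Kf.
    by apply/commute_sym/commute_conjg; rewrite {2}eq_k conjgM.
  apply/ffunP => i; rewrite !ffunE; congr (inord (index _ _)).
  have /ksP[_ Tk] : ks`_i \in ks by rewrite mem_nth.
  by apply/esym/(conj_centralizer nT).
have /choice[rho rhoP] i : exists f,
    (exists2 f', F f' & phi f' = i) -> F f /\ phi f = i.
  have [[f Ff fi]|no] := pselect (exists2 f', F f' & phi f' = i); last by exists 1.
  by exists f.
have rhoF f : F f -> F (rho (phi f)) /\ phi (rho (phi f)) = phi f.
  by move=> Ff; apply: rhoP; exists f.
pose J := [seq i <- enum {ffun 'I_(size ks) -> 'I_(size ks).+1} |
  `[< exists2 f, F f & phi f = i >]].
have JP x : x \in map rho J -> exists2 f, F f & x = rho (phi f).
  by case/mapP => i; rewrite mem_filter => /andP[/asboolP[f Ff <-] _] ->; exists f.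
exists (map rho J); split=> [|x /JP[f Ff ->]|f Ff|x y /JP[f Ff ->] /JP[g Fg ->]].
- rewrite map_inj_in_uniq => [|i j]; first exact/filter_uniq/enum_uniq.
  rewrite !mem_filter => /andP[/asboolP[f Ff <-] _] /andP[/asboolP[g Fg <-] _] E.
  by have [[_ <-] [_ <-]] := (rhoF f Ff, rhoF g Fg); rewrite E.
- by case: (rhoF f Ff).
- exists (rho (phi f)); last by apply/phiP; case: (rhoF f Ff).
  by apply/map_f; rewrite mem_filter mem_enum andbT; apply/asboolP; exists f.
have [[Frf Ef] [Frg Eg]] := (rhoF f Ff, rhoF g Fg).
by move/phiP => /(_ Frf Frg); rewrite Ef Eg => ->.
Qed.

(* The product of the t ^ x, for x in the transversal r, is fixed by F, hence
   central, and it is congruent to t ^+ size r modulo the centralizer of M. *)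
Lemma rigid_norm_power r : uniq r -> (forall x, x \in r -> F x) ->
  (forall f, F f -> exists2 x, x \in r & centralizer T (x^-1 * f)) ->
  {in r &, forall x y, centralizer T (x^-1 * y) -> x = y} ->
  forall M t, is_normal_subgroup M -> M `<=` T -> M t ->
  (forall f, F f -> centralizer M [~ t, f]) -> centralizer M (t ^+ size r).
Proof.
move=> r_uniq rF r_cover r_inj M t nM MT Mt tF.
have sM := normal_subgroup nM; have sC := centralizer_subgroup M.
have eq_u : centralizer M ((t ^+ size r)^-1 * \prod_(x <- r) t ^ x).
  elim: (r) rF => [|x r' IHr] r'F.
    by rewrite big_nil expg0 invg1 mulg1; apply: subgroup1.
  have {}IHr := IHr (fun y yr => r'F y (mem_behead (s := x :: r') yr)).
  have Cx := tF x (r'F x (mem_head _ _)).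
  have := subgroupM sC (normalJ (centralizer_normal nM) (t ^+ size r') Cx) IHr.
  by congr centralizer; rewrite big_cons /= expgS commgEl conjgE !invgM -!mulgA mulVKg.
suff u_cent f : F f -> commute (\prod_(x <- r) t ^ x) f.
  have Cu : centralizer M (\prod_(x <- r) t ^ x).
    by move=> m _; apply: rigid_fixed_central.
  by apply/(subgroupVE _ sC); move/(subgroupMr _ sC): eq_u; apply.
move=> Ff; apply/commute_conjg; rewrite conjg_prod.
(* Right multiplication by [f] permutes the cosets that [r] represents. [sg] is the resulting
   permutation of [r], so conjugation by [f] only reorders the factors. *)
have /choice[sg sgP] x : exists y, x \in r -> y \in r /\ centralizer T (y^-1 * (x * f)).
  have [xr|nxr] := boolP (x \in r); last by exists 1.
  by have [y yr Cy] := r_cover (x * f) (subgroupM sF (rF x xr) Ff); exists y.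
have -> : \prod_(x <- r) (t ^ x) ^ f = \prod_(x <- [seq t ^ x | x <- map sg r]) x.
  rewrite -map_comp big_map !big_seq; apply: eq_bigr => x /sgP[_ Cx] /=.
  by rewrite -conjgM; apply: (conj_centralizer nT) => //; apply: MT.
rewrite -(big_map (fun x => t ^ x) xpredT id).
have sg_sub : {subset map sg r <= r} by move=> _ /mapP[x /sgP[? _] ->].
have sg_uniq : uniq (map sg r).
  rewrite map_inj_in_uniq // => x y xr yr E; apply: r_inj => //.
  have [[_ Cx] [_ Cy]] := (sgP x xr, sgP y yr); rewrite E in Cx.
  have sCT := centralizer_subgroup T.
  have := subgroupM sCT (subgroupV sCT Cx) Cy.
  rewrite !invgM !invgK -!mulgA mulVKg => Cxy.
  by apply/(normalJE _ f (centralizer_normal nT)); rewrite conjgE -!mulgA.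
have [_ sg_eq] := uniq_min_size sg_uniq sg_sub (eq_leq (esym (size_map sg r))).
apply: perm_prod_commute; first by apply/perm_map/uniq_perm.
(* Each factor is [t] times an element of [M] that centralizes [M], so the factors commute. *)
have comt x y : F x -> F y -> commute (t ^ x) (t ^ y).
  move=> Fx Fy; rewrite -[t ^ x](mulVKg t) -[t ^ y](mulVKg t) -!commgEl.
  have [Ctx Cty] := (tF x Fx, tF y Fy).
  have [Mtx Mty] := (normalR x nM Mt, normalR y nM Mt).
  apply: commuteM; last by apply/commute_sym/Cty/(subgroupM sM).
  by apply/commute_sym/commuteM; [exact: commute_refl|apply/commute_sym/Ctx].
move=> _ _ /mapP[x /sg_sub xr ->] /mapP[y /sg_sub yr ->].
by apply: comt; apply: rF.
Qed.

End RigidTorsion.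

Lemma expg_modn (G : groupType) (z : G) p i : z ^+ p = 1 -> z ^+ (i %% p) = z ^+ i.
Proof.
by move=> zp; rewrite [in RHS](divn_eq i p) expgnDr mulnC expgnA zp expg1n mul1g.
Qed.

(** G / X is cyclic of order [p], generated by [x]. Writing phi(g) for the exponent of [g] there, g
    |-> g z^phi(g) is an automorphism that fixes [gen s] and sends [x] to [x * z]. *)
Lemma rigid_index_p (G : groupType) (s : seq G) (X : set G) p x z : rigid s ->
  is_subgroup X -> gen s `<=` X -> (forall g h, X [~ g, h]) -> prime p -> ~ X x ->
  (forall y, X (y ^+ p)) -> (forall y, exists2 i, (i < p)%N & X ((x ^+ i)^-1 * y)) ->
  gen s z -> z ^+ p = 1 -> (forall g, commute z g) -> z = 1.
Proof.
move=> rig sX FX XR p_pr nXx Xp Xx Fz zp z_cent.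
have sG : is_subgroup [set: G] by [].
have XG : X `<=` [set: G] by [].
have XRG g h : [set: G] g -> [set: G] h -> X [~ g, h] by move=> _ _; apply: XR.
have /choice[phi phiP] y : exists i, X ((x ^+ i)^-1 * y).
  by have [i _ Xi] := Xx y; exists i.
have X_dvd m : X (x ^+ m) -> p %| m.
  move=> Xm; rewrite -[_ %| _]negbK -prime_coprime //; apply/negP => co_pm.
  by apply: nXx; apply: (subgroup_coprimeX sX co_pm).
(* [phi] is a chosen exponent, determined only modulo [p]; the power of [z] does not depend on the
   choice. *)
have z_phi y i : X ((x ^+ i)^-1 * y) -> z ^+ i = z ^+ phi y.
  move=> Xi; have Xij : X ((x ^+ i)^-1 * x ^+ phi y).
    by apply: (eq_mod_trans sX Xi); apply: (eq_mod_sym sX).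
  have [le_ij|/ltnW le_ji] := leqP i (phi y).
    move: Xij; rewrite -{1}(subnKC le_ij) expgnDr mulKg => /X_dvd/dvdnP[k Ek].
    by rewrite -(subnKC le_ij) Ek expgnDr mulnC expgnA zp expg1n mulg1.
  move: (subgroupV sX Xij); rewrite invgM invgK -{1}(subnKC le_ji) expgnDr mulKg.
  move=> /X_dvd/dvdnP[k Ek].
  by rewrite -{1}(subnKC le_ji) Ek expgnDr mulnC expgnA zp expg1n mulg1.
have z_phiM g h : z ^+ phi (g * h) = z ^+ phi g * z ^+ phi h.
  rewrite -expgnDr; apply/esym/z_phi; rewrite expgnDr.
  exact: (eq_modM sX XG XRG).
have z_phiX y : X y -> z ^+ phi y = 1.
  by move=> Xy; rewrite -(z_phi _ 0%N) ?expg0 // invg1 mul1g.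
have z_phiZ g i : z ^+ phi (g * z ^+ i) = z ^+ phi g.
  rewrite z_phiM [X in _ * X]z_phiX ?mulg1 //; apply: (subgroupX _ sX); exact: FX.
pose be g := g * z ^+ phi g.
have be_id : be =1 id.
  apply: (rigid_gen rig) => [|f Ff]; last by rewrite /be z_phiX ?mulg1 //; apply: FX.
  split; last first.
    move=> g h; rewrite /be z_phiM -!mulgA; congr (_ * _); rewrite !mulgA.
    by congr (_ * _); apply/esym/commute_sym/commuteX/commute_sym/z_cent.
  apply: inj_surj_bijective => [g h|g].
    rewrite /be => E; apply: (mulIg (z ^+ phi g)); rewrite E.
    by congr (_ * _); rewrite -(z_phiZ g (phi g)) E z_phiZ.
  exists (g * z ^+ (phi g * p.-1)); rewrite /be z_phiZ -mulgA -expgnDr addnC.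
  by rewrite -mulnS prednK ?prime_gt0 // mulnC expgnA zp expg1n mulg1.
have := be_id x; rewrite /be -(z_phi x 1%N) expg1; last first.
  by rewrite mulVg; apply: subgroup1.
by move/(congr1 ( *%g x^-1)); rewrite /= mulKg mulVg.
Qed.

(** * Normal subgroups of finite m-power index *)

(** The subgroup generated by [B] is normalized by [A], hence normal. The commutator identities then
    extend the inclusion from [A] to the whole group, one argument at a time. *)
Lemma generated_commutators (G : groupType) (A B : set G) :
  (forall g, generated A g) -> B `<=` A -> (forall a, A a -> A a^-1) ->
  (forall a b, A a -> A b -> generated B [~ a, b]) ->
  forall g h, generated B [~ g, h].
Proof.
move=> genA BA AV AB; set E := generated B.
have sE : is_subgroup E := generated_subgroup B.
have EJ g : forall e, E e -> E (e ^ g).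
  pose N := [set g | (forall e, E e -> E (e ^ g)) /\ (forall e, E e -> E (e ^ g^-1))].
  suff [] : N g by [].
  move: (genA g); apply: (generated_min (H := N)).
    apply: is_subgroupP => [|x y [Nx NVx] [Ny NVy]|x [Nx NVx]].
    - by split=> e; rewrite ?invg1 conjg1.
    - split=> e Ee; first by rewrite conjgM; apply: Ny; apply: Nx.
      by rewrite invgM conjgM; apply: NVx; apply: NVy.
    - by split; rewrite ?invgK.
  have AJ a : A a -> forall e, E e -> E (e ^ a).
    move=> Aa; apply: (generated_min (H := [set e | E (e ^ a)])) => [|b Bb].
      apply: is_subgroupP => [|x y Ex Ey|x Ex] /=.
      - by rewrite conj1g; apply: subgroup1.
      - by rewrite conjMg; apply: (subgroupM sE).
      - by rewrite conjVg; apply: (subgroupV sE).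
    rewrite /= -[b ^ a](mulVKg b) -commgEl.
    apply: (subgroupM sE); first exact: sub_generated.
    by apply: AB => //; apply: BA.
  by move=> a Aa; split; apply: AJ => //; apply: AV.
have AE a h : A a -> E [~ a, h].
  move=> Aa; pose N := [set h | E [~ a, h]].
  move: (genA h); apply: (generated_min (H := N)) => [|b Ab]; last exact: AB.
  apply: is_subgroupP => [|x y Nx Ny|x Nx]; rewrite /N /=.
  - by rewrite commg1; apply: (subgroup1 sE).
  - by rewrite commgMr; apply: (subgroupM sE) => //; apply: EJ.
  - by rewrite commgVr; apply: (subgroupV sE); apply: EJ.
move=> g h; pose N := [set g | E [~ g, h]].
move: (genA g); apply: (generated_min (H := N)) => [|b Ab]; last exact: AE.
apply: is_subgroupP => [|x y Nx Ny|x Nx]; rewrite /N /=.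
- by rewrite comm1g; apply: (subgroup1 sE).
- by rewrite commgMl; apply: (subgroupM sE) => //; apply: EJ.
- by rewrite commgVl; apply: (subgroupV sE); apply: EJ.
Qed.

Lemma normal_mul_subgroup (G : groupType) (H N : set G) :
  is_subgroup H -> is_normal_subgroup N ->
  is_subgroup [set g | exists2 h, H h & N (h^-1 * g)].
Proof.
move=> sH nN; have sN := normal_subgroup nN.
apply: is_subgroupP => [|x y [h Hh Nx] [k Hk Ny]|x [h Hh Nx]].
- by exists 1; [|rewrite mulg1 invg1]; apply: subgroup1.
- exists (h * k); first exact: (subgroupM sH).
  by have := subgroupM sN (normalJ nN k Nx) Ny; rewrite conjgE !invgM -!mulgA mulVKg.
- exists h^-1; first exact: (subgroupV sH).
  have := normalJ nN h^-1 (subgroupV sN Nx).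
  by rewrite conjgE !invgM !invgK -!mulgA mulgV mulg1.
Qed.

(** T / N is finite, of exponent dividing a power of [m]; this is said without forming the
    quotient. *)
Definition power_cofinite (G : groupType) (T : set G) m (N : set G) :=
  [/\ is_normal_subgroup N, N `<=` T,
      exists l : seq G, forall t, T t -> exists2 x, x \in l & N (x^-1 * t) &
      exists j, forall t, T t -> N (t ^+ (m ^ j))].

(** * F as a supplement of these normal subgroups *)

Section Cover.
Variables (G : groupType) (s : seq G) (m : nat).
Hypotheses (lnG : locally_nilpotent G) (rig : rigid s) (m_gt0 : 0 < m).
Let F := gen s.
Let T := torsion G.
Hypothesis FT : forall g, exists2 f, F f & T (f^-1 * g).
Hypothesis F_central : forall p, prime p -> p %| m ->
  (exists x, [/\ T x, x ^+ p = 1 & x <> 1]) ->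
  exists z, [/\ F z, z ^+ p = 1, z <> 1 & forall g, commute z g].
Let sF : is_subgroup F := gen_subgroup s.
Let nT : is_normal_subgroup T := torsion_normal lnG.
Let sT : is_subgroup T := normal_subgroup nT.

(** G / D is divisible by each prime [p] dividing [m]: otherwise some subgroup [X] of index [p]
    contains [D], an element of [T] lies outside [X], so [T] has an element of order [p] and [F] a
    central one, against [rigid_index_p]. Hence every element is congruent modulo [D] to some (f
    t)^(m^j), and so to f^(m^j) t^(m^j), which lies in [D]. *)
Lemma rigid_divisible_mod (D : set G) : is_subgroup D -> F `<=` D ->
  (forall g h, D [~ g, h]) -> (exists j, forall t, T t -> D (t ^+ (m ^ j))) ->
  forall g, D g.
Proof.
move=> sD FD DR [j Dj]; have sG : is_subgroup [set: G] by [].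
have DG : D `<=` [set: G] by [].
have DRG g h : [set: G] g -> [set: G] h -> D [~ g, h] by move=> _ _; apply: DR.
suff divm p : prime p -> p %| m ->
    forall x, [set: G] x -> exists2 y, [set: G] y & D ((y ^+ p)^-1 * x).
  have mj_gt0 : 0 < m ^ j by rewrite expn_gt0 m_gt0.
  have pi_mj : {subset \pi((m ^ j)%N) <= \pi(m)}.
    move=> q; rewrite mem_primes => /and3P[q_pr _].
    rewrite Euclid_dvdX // => /andP[q_m _].
    by rewrite mem_primes q_pr m_gt0.
  move=> g.
  have [y _ Dy] := abelian_divisible_primes sG sD DG DRG divm mj_gt0 pi_mj (x := g) I.
  rewrite -[g](mulVKg (y ^+ (m ^ j))); apply: (subgroupM sD) Dy.
  have [f Ff Tf] := FT y; rewrite -(mulVKg f y).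
  have Dft := eq_mod_expgM sG sD DG DRG (x := f) (y := f^-1 * y) (m ^ j) I I.
  rewrite -[X in D X](mulVKg (f ^+ (m ^ j) * (f^-1 * y) ^+ (m ^ j))).
  apply: (subgroupM sD) Dft; apply: (subgroupM sD); last exact: Dj.
  by apply: (subgroupX _ sD); apply: FD.
move=> p_pr p_m x _; apply: contrapT => ndiv.
have x_ndiv y : [set: G] y -> ~ D ((y ^+ p)^-1 * x).
  by move=> _ Dy; apply: ndiv; exists y.
have [X [sX [DX _] nXx Xp Xx]] :=
  exists_index_p_subgroup sG sD DG DRG p_pr (x := x) I x_ndiv.
have [f Ff Tf] := FT x; set t := f^-1 * x in Tf.
have nXt : ~ X t by move=> /(subgroupM sX (DX _ (FD _ Ff))); rewrite mulVKg.
have [N N_gt0 tN] := Tf; pose w := t ^+ (N`_p^').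
have w1 : w <> 1.
  move=> w1; apply: nXt; apply: (@subgroup_coprimeX _ _ _ (N`_p^') p sX).
  - rewrite coprime_sym; apply: (@pnat_coprime p); last exact: part_pnat.
    by rewrite pnat_id.
  - by rewrite -/w w1; apply: subgroup1.
  - exact: Xp.
have wp : w ^+ (p ^ logn p N) = 1 by rewrite -expgnA -p_part mulnC partnC.
have [i [wi1 wip]] := prime_order_expg w1 wp.
have [|z [Fz zp z1 z_cent]] := F_central p_pr p_m.
  by exists (w ^+ (p ^ i)); split=> //; do 2 apply: (subgroupX _ sT).
apply: z1; apply: (rigid_index_p rig sX (fun f Ff => DX _ (FD f Ff)) _ p_pr nXx) => //.
- by move=> g h; apply: DX.
- by move=> y; apply: Xp.
- by move=> y; apply: Xx.
Qed.

(** With [H] generated by [s] and [l], the group is generated by [F], [N] and any term of the lower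
    central series of [H]. To pass to the next term, note that the smaller subgroup contains all
    commutators and apply [rigid_divisible_mod]. The series ends at 1. *)
Lemma power_cofinite_cover N : power_cofinite T m N ->
  forall g, exists2 f, F f & N (f^-1 * g).
Proof.
move=> [nN NT [l lP] [j Nj]] g0; have sN := normal_subgroup nN.
have sB := normal_mul_subgroup sF nN; apply: contrapT => nBg0.
pose H := gen (s ++ l); have sH : is_subgroup H := gen_subgroup _.
have FH : F `<=` H by apply: gen_sub => x xs; rewrite mem_cat xs.
have lH x : x \in l -> H x by move=> xl; apply: mem_gen; rewrite mem_cat xl orbT.
have [c Lc] : is_nilpotent H := gen_nilpotent _ lnG.
pose A i := F `|` N `|` lower_central H i.
suff AG i : forall g, generated (A i) g.
  apply: nBg0; move: (AG c g0); apply: (generated_min sB) => x [[Fx|Nx]|].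
  - by exists x; rewrite // mulVg; apply: subgroup1.
  - by exists 1; rewrite ?invg1 ?mul1g //; apply: subgroup1.
  - by rewrite Lc => ->; exists 1; [|rewrite mulg1 invg1]; apply: subgroup1.
elim: i => [|i IHi].
  have sA := generated_subgroup (A 0%N).
  move=> g; have [f Ff Tg] := FT g; rewrite -(mulVKg f g).
  apply: (subgroupM sA); first by apply: sub_generated; left; left.
  have [x xl Nx] := lP _ Tg; rewrite -(mulVKg x (_ * _)); apply: (subgroupM sA).
    by apply: sub_generated; right; apply: lH.
  by apply: sub_generated; left; right.
apply: rigid_divisible_mod.
- exact: generated_subgroup.
- by move=> f Ff; apply: sub_generated; left; left.
- apply: (generated_commutators IHi) => [x|a|a b].
  + by case=> [?|/(lower_central_le sH)?]; [left|right].
  + move=> [[Fa|Na]|La]; [left; left|left; right|right].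
    * exact: (subgroupV sF).
    * exact: (subgroupV sN).
    * exact: (subgroupV (lower_central_subgroup sH i)).
  have inN x : N x -> generated (A i.+1) x.
    by move=> Nx; apply: sub_generated; left; right.
  have inL x : lower_central H i.+1 x -> generated (A i.+1) x.
    by move=> Lx; apply: sub_generated; right.
  move=> [[Fa|Na]|La]; last 2 first.
  + by move=> _; apply: inN; apply: normalR.
  + case=> [[Fb|Nb]|Lb]; [|by apply: inN; apply: normalRl|].
      by apply: inL; apply: lower_central_comm => //; apply: FH.
    by apply: inL; apply: lower_central_comm => //; apply: (lower_central_sub sH) Lb.
  case=> [[Fb|Nb]|Lb]; [|by apply: inN; apply: normalRl|].
    by apply: sub_generated; left; left; apply: (subgroupR sF).
  rewrite -invgR; apply: (subgroupV (generated_subgroup _)).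
  by apply: inL; apply: lower_central_comm => //; apply: FH.
- by exists j => t Tt; apply: sub_generated; left; right; apply: Nj.
Qed.

End Cover.

(** * The smallest of these normal subgroups *)

Section MinimalCofinite.
Variables (G : groupType) (s : seq G) (m : nat).
Hypotheses (lnG : locally_nilpotent G) (rig : rigid s) (m_gt0 : 0 < m).
Let F := gen s.
Let T := torsion G.
Hypothesis FT : forall g, exists2 f, F f & T (f^-1 * g).
Hypothesis F_central : forall p, prime p -> p %| m ->
  (exists x, [/\ T x, x ^+ p = 1 & x <> 1]) ->
  exists z, [/\ F z, z ^+ p = 1, z <> 1 & forall g, commute z g].
Let sF : is_subgroup F := gen_subgroup s.
Let nT : is_normal_subgroup T := torsion_normal lnG.
Let sT : is_subgroup T := normal_subgroup nT.

(** Choose [R] with the fewest elements in F /\ T. If N <= R is another candidate, both contain the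
    same elements of F /\ T, and F N = G gives R = (F /\ R) N = N. *)
Lemma exists_minimal_power_cofinite : exists R, power_cofinite T m R /\
  forall N, power_cofinite T m N -> N `<=` R -> R `<=` N.
Proof.
have /finite_seqP[ks0 Kks] := rigid_finite_torsion s lnG.
pose ks := undup ks0.
have ksP k : k \in ks <-> F k /\ T k.
  by rewrite mem_undup -[_ /\ _]/((F `&` T) k) Kks.
pose mu (N : set G) := size [seq k <- ks | `[< N k >]].
have ex : exists n, `[< exists N, power_cofinite T m N /\ mu N = n >].
  exists (mu T); apply/asboolP; exists T; split=> //; split=> //.
    by exists [:: 1] => t Tt; exists 1; rewrite ?mem_head // invg1 mul1g.
  by exists 0%N => t Tt; rewrite expg1.
case: (ex_minnP ex) => n /asboolP[R [pcR muR]] min_n; exists R.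
split=> // N pcN NR r Rr.
have [k Fk Nkr] := power_cofinite_cover lnG rig m_gt0 FT F_central pcN r.
have [nN NT _ _] := pcN; have [nR RT _ _] := pcR.
rewrite -(mulVKg k r); apply: (normalM nN) => //.
have sR := normal_subgroup nR.
have Rk : R k by apply/(subgroupVE _ sR)/(subgroupMr _ sR Rr)/NR.
pose flt (N : set G) := [seq k <- ks | `[< N k >]].
have [|||_ eq_flt] := @uniq_min_size _ (flt N) (flt R).
- by apply/filter_uniq/undup_uniq.
- by move=> x; rewrite !mem_filter => /andP[/asboolP/NR/asboolP -> ->].
- by rewrite [size (flt R)]muR; apply: min_n; apply/asboolP; exists N.
have : k \in flt R.
  rewrite mem_filter; apply/andP; split; first exact/asboolP.
  by apply/ksP; split=> //; apply: RT.
by rewrite -eq_flt mem_filter => /andP[/asboolP].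
Qed.

Variable R : set G.
Hypotheses (pcR : power_cofinite T m R).
Hypothesis minR : forall N, power_cofinite T m N -> N `<=` R -> R `<=` N.
Let nR : is_normal_subgroup R. Proof. by case: pcR. Qed.
Let sR : is_subgroup R := normal_subgroup nR.
Let RT : R `<=` T. Proof. by case: pcR. Qed.
Let R_cover g : exists2 f, F f & R (f^-1 * g).
Proof. exact: (power_cofinite_cover lnG rig m_gt0 FT F_central pcR g). Qed.
Let R' := comm_subgroup R R.
Let sR' : is_subgroup R'. Proof. exact: generated_subgroup. Qed.
Let R'R : R' `<=` R.
Proof. by apply: generated_min => // _ [x [y [Rx Ry ->]]]; apply: subgroupR. Qed.
Let R'_comm x y : R x -> R y -> R' [~ x, y].
Proof. by move=> Rx Ry; apply: sub_generated; exists x, y. Qed.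

(** A failure gives a subgroup [X] of index [p] in [R] containing [R']. As G = F R, [R] normalizes
    [X] and [F] acts on [T] through a finite group, [X] has finitely many conjugates; their
    intersection [N] contradicts the minimality of [R]. *)
Lemma minimal_cofinite_divisible_prime p : prime p -> p %| m ->
  forall x, R x -> exists2 y, R y & R' ((y ^+ p)^-1 * x).
Proof.
move=> p_pr p_m x Rx; apply: contrapT => ndiv.
have x_ndiv y : R y -> ~ R' ((y ^+ p)^-1 * x) by move=> Ry R'y; apply: ndiv; exists y.
have [X [sX [R'X XR] nXx Xp Xx]] :=
  exists_index_p_subgroup sR sR' R'R R'_comm p_pr Rx x_ndiv.
have XJ w y : X w -> R y -> X (w ^ y).
  move=> Xw Ry; rewrite -[w ^ y](mulVKg w) -commgEl; apply: (subgroupM sX) => //.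
  by apply: R'X; apply: R'_comm => //; apply: XR.
pose N := [set y | R y /\ forall g, X (y ^ g)].
have NR : N `<=` R by move=> y [].
suff pcN : power_cofinite T m N.
  by apply: nXx; have [_ /(_ 1)] := minR pcN NR Rx; rewrite conjg1.
have nN : is_normal_subgroup N.
  split; last first.
    by move=> y g [Ry Ny]; split=> [|h]; [apply: normalJ|rewrite -conjgM].
  apply: is_subgroupP => [|y z [Ry Ny] [Rz Nz]|y [Ry Ny]].
  - by split=> [|g]; rewrite ?conj1g; apply: subgroup1.
  - by split=> [|g]; [apply: (subgroupM sR)|rewrite conjMg; apply: (subgroupM sX)].
  - by split=> [|g]; [apply: (subgroupV sR)|rewrite conjVg; apply: (subgroupV sX)].
have [_ _ [l lP] [j Rj]] := pcR; split=> //; first exact: subset_trans NR RT.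
  have [r [r_uniq rF r_cover r_inj]] := rigid_transversal lnG rig FT.
  (* Only the conjugates by members of [r] need checking. *)
  have Nr y : R y -> (forall z, z \in r -> X (y ^ z)) -> N y.
    move=> Ry Xr; split=> // g; have [f Ff Rg] := R_cover g.
    have [z zr Cz] := r_cover f Ff.
    rewrite -(mulVKg f g) conjgM; apply: XJ => //.
    by rewrite (conj_centralizer nT (x := z)) //; [apply: Xr|apply: RT].
  pose ind (y z : G) (i : 'I_p) := X ((x ^+ i)^-1 * y ^ z).
  (* [phi y] lists the cosets modulo [X] of the [y ^ z] for [z] in [r]. Elements with equal lists
     agree modulo [N], so one representative [w v] per list is enough. *)
  have /choice[phi phiP] y : exists v : {ffun 'I_(size r) -> 'I_p},
      R y -> forall k : 'I_(size r), ind y r`_k (v k).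
    have [Ry|nRy] := pselect (R y); last first.
      by exists [ffun=> Ordinal (prime_gt0 p_pr)].
    have /choice[v vP] (k : 'I_(size r)) : exists i, ind y r`_k i.
      by have [i i_lt Xi] := Xx _ (normalJ nR r`_k Ry); exists (Ordinal i_lt).
    by exists [ffun k => v k] => _ k; rewrite ffunE.
  have /choice[w wP] v : exists y, (exists2 z, R z & phi z = v) -> R y /\ phi y = v.
    by have [[y Ry yv]|no] := pselect (exists2 z, R z & phi z = v); [exists y|exists 1].
  exists [seq a * w v | a <- l, v <- enum {ffun 'I_(size r) -> 'I_p}] => t Tt.
  have [a al Ra] := lP t Tt; pose y := a^-1 * t.
  have [Rw Ew] : R (w (phi y)) /\ phi (w (phi y)) = phi y by apply: wP; exists y.
  exists (a * w (phi y)).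
    by apply/allpairsP; exists (a, phi y); rewrite mem_enum.
  rewrite invgM -mulgA -/y; apply: Nr.
    by apply: (subgroupM sR) => //; apply: (subgroupV sR).
  move=> z zr; rewrite conjMg conjVg.
  have k_lt : (index z r < size r)%N by rewrite index_mem.
  have Xw := phiP _ Rw (Ordinal k_lt); have Xy := phiP _ Ra (Ordinal k_lt).
  rewrite Ew /ind /= nth_index // in Xw; rewrite /ind /= nth_index // in Xy.
  exact: (eq_mod_trans sX (eq_mod_sym sX Xw) Xy).
(* The extra factor [m], a multiple of [p], sends [R] into [X]. *)
exists j.+1 => t Tt; have Rtj := Rj t Tt; rewrite expnSr expgnA; split.
  exact: (subgroupX _ sR).
move=> g; rewrite conjXg; set w := _ ^ g.
have -> : w ^+ m = w ^+ p ^+ (m %/ p) by rewrite -expgnA mulnC divnK.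
by apply: (subgroupX _ sX); apply: Xp; apply: normalJ.
Qed.

Lemma minimal_cofinite_divisible n : 0 < n -> {subset \pi(n) <= \pi(m)} ->
  forall x, R x -> exists2 y, R y & R' ((y ^+ n)^-1 * x).
Proof.
apply: (abelian_divisible_primes sR sR' R'R R'_comm).
exact: minimal_cofinite_divisible_prime.
Qed.

Variable n : nat.
Hypotheses (n_gt0 : 0 < n) (pi_n : {subset \pi(n) <= \pi(m)}).
Hypothesis norm_n : forall t, R t ->
  (forall f, F f -> centralizer R [~ t, f]) -> centralizer R (t ^+ n).

Let almost_central t := R t /\ forall f, F f -> centralizer R [~ t, f].

(* P = R, because P contains the commutators and the n-th powers of R. *)
Let P := [set k | R k /\ exists l : seq G, forall t, almost_central t ->
  (forall x, x \in l -> centralizer R [~ t, x]) -> commute t k].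

Let sP : is_subgroup P.
Proof.
apply: is_subgroupP => [|x y [Rx [l lP]] [Ry [l' lP']]|x [Rx [l lP]]].
- split; first exact: (subgroup1 sR).
  by exists [::] => t _ _; apply: commute1.
- split; first exact: (subgroupM sR).
  exists (l ++ l') => t ct tl; apply: commuteM.
    by apply: lP => // z zl; apply: tl; rewrite mem_cat zl.
  by apply: lP' => // z zl; apply: tl; rewrite mem_cat zl orbT.
- split; first exact: (subgroupV sR).
  by exists l => t ct tl; apply: commuteV; apply: lP.
Qed.

Let conj_almost t x : R t -> centralizer R [~ t, x] -> R x ->
  exists a, [/\ R a, centralizer R a, a = [~ t, x]^-1 & x ^ t = x * a].
Proof.
move=> Rt Ct Rx; exists [~ x, t]; split=> //.
- exact: (subgroupR sR).
- by rewrite -invgR; apply: (subgroupV (centralizer_subgroup R)).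
- by rewrite invgR.
- by rewrite commgEl mulVKg.
Qed.

Let P_R k : R k -> P k.
Proof.
(* Conjugation by [t] multiplies [x] and [y] by elements of the centre of [R], which leaves [x, y]
   unchanged. *)
have R'P : R' `<=` P.
  apply: generated_min => // _ [x [y [Rx Ry ->]]]; split; first exact: (subgroupR sR).
  exists [:: x; y] => t [Rt _] tl; apply/commute_sym/commute_conjg.
  have [a [Ra Ca _ Ea]] := conj_almost Rt (tl x (mem_head _ _)) Rx.
  have [|b [Rb Cb _ Eb]] := conj_almost Rt (tl y _) Ry.
    by rewrite !inE eqxx orbT.
  rewrite conjRg Ea Eb commgMl.
  have /commgP/eqP -> : commute a (y * b) by apply/Ca/(subgroupM sR).
  rewrite mulg1 commgMr.
  have /commgP/eqP -> : commute x b by apply/commute_sym/Cb.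
  have Rxy := subgroupR sR Rx Ry.
  have /commute_conjg -> : commute [~ x, y] b by apply/commute_sym/Cb.
  by rewrite mul1g; apply/commute_conjg/commute_sym/Ca.
move=> Rk; have [y Ry R'k] := minimal_cofinite_divisible n_gt0 pi_n Rk.
rewrite -[k](mulVKg (y ^+ n)); apply: (subgroupM sP); last exact: R'P.
split; first exact: (subgroupX _ sR).
exists [:: y] => t [Rt tF] tl; apply/commute_sym/commute_conjg.
have Cty := tl y (mem_head _ _).
have [a [Ra Ca Ea Ey]] := conj_almost Rt Cty Ry.
rewrite conjXg Ey expgMn; last exact/commute_sym/Ca.
(* [t ^+ n] commutes with [y] and [t, y] is central in [R], so the [n]-th power of [t, y] is
   trivial. *)
suff -> : a ^+ n = 1 by rewrite mulg1.
rewrite Ea expVgn; apply/eqP; rewrite invg_eq1; apply/eqP.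
have /(_ y Ry)/commute_conjg := norm_n Rt tF.
rewrite conjXg -[t ^ y](mulVKg t) -commgEl expgMn; last exact/commute_sym/Cty.
by move/(congr1 ( *%g (t ^+ n)^-1)); rewrite mulKg mulVg.
Qed.

Lemma minimal_cofinite_abelian x y : R x -> R y -> commute x y.
Proof.
move=> Rx; move: y; apply: contrapT => nCx.
have /finite_seqP[ks Kks] := rigid_finite_torsion s lnG.
(* F /\ R is finite, so the lists attached to its elements combine into a single one. *)
have [L LP] : exists L : seq G, forall t, almost_central t ->
    (forall x, x \in L -> centralizer R [~ t, x]) ->
    forall k, k \in ks -> R k -> commute t k.
  elim: (ks) => [|k ks' [L LP]]; first by exists [::].
  have [Rk|nRk] := pselect (R k); last first.
    exists L => t ct tL h; rewrite inE => /orP[/eqP ->//|]; exact: LP.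
  have [_ [l lP]] := P_R Rk; exists (l ++ L) => t ct tL h.
  rewrite inE => /orP[/eqP -> _|hks Rh].
    by apply: lP => // z zl; apply: tL; rewrite mem_cat zl.
  by apply: LP => // z zL; apply: tL; rewrite mem_cat zL orbT.
(* [H] contains [x], [F] and [L], so the [t] found below is almost central and commutes with F /\ R;
   [rigid_conj] then puts it in the centre of [R]. *)
pose H := gen (x :: s ++ L); have sH : is_subgroup H := gen_subgroup _.
have Hx : H x by apply: mem_gen; rewrite mem_head.
have FH : F `<=` H by apply: gen_sub => z zs; rewrite inE mem_cat zs orbT.
have [||t [Rt Ht nCt tH]] := nilpotent_last_commutator (M := R) (A := centralizer R)
    (gen_nilpotent _ lnG) _ _ sH Rx Hx nCx.
- exact: (subgroup1 (centralizer_subgroup R)).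
- by move=> z h Rz _; apply: normalR.
apply: nCt; apply: (rigid_conj rig nR R_cover) => [f Ff|k Rk Fk].
  by apply: tH; apply: FH.
apply/commute_sym/LP => //.
- by split=> // f Ff; apply: tH; apply: FH.
- by move=> z zL; apply: tH; apply: mem_gen; rewrite inE mem_cat zL !orbT.
- by have : (F `&` T) k by [split=> //; apply: RT]; rewrite Kks.
Qed.

End MinimalCofinite.

(** * Power automorphisms *)

(* Raising to the power k is y |-> y ^+ m.+1 on the \pi(m)-part of a group of
   exponent N, and inversion on its \pi(m)^'-part. *)
Definition split_exponent m N k :=
  k = m.+1 %[mod N`_\pi(m)] /\ N`_(\pi(m))^' %| k.+1.

Section SplitExponent.
Variable m : nat.
Local Notation pi := (\pi(m)).

Lemma split_exponent_exists N : 0 < N -> exists k, split_exponent m N k.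
Proof.
move=> N_gt0; have co : coprime N`_pi N`_pi^' by apply: coprime_partC.
exists (chinese N`_pi N`_pi^' m.+1 (N`_pi^').-1); split; first exact: chinese_modl.
have := chinese_modr co m.+1 (N`_pi^').-1; set k := chinese _ _ _ _ => Ek.
by rewrite -addn1 /dvdn -modnDml Ek modnDml addn1 prednK ?part_gt0 // modnn.
Qed.

Lemma split_exponentMl N N' k : 0 < N -> 0 < N' ->
  split_exponent m (N * N') k -> split_exponent m N k.
Proof.
move=> N0 N'0 []; rewrite !partnM // => Ek dvd_k; split.
  have d : N`_pi %| (N`_pi * N'`_pi)%N by apply: dvdn_mulr.
  by rewrite -(modn_dvdm k d) Ek modn_dvdm.
by apply: dvdn_trans dvd_k; apply: dvdn_mulr.
Qed.

Lemma split_exponent_unique N k k' : 0 < N -> split_exponent m N k ->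
  split_exponent m N k' -> k = k' %[mod N].
Proof.
move=> N0 [Ek dk] [Ek' dk']; apply/eqP.
rewrite -(partnC pi N0) chinese_remainder ?coprime_partC //.
rewrite Ek Ek' eqxx /= -(eqn_modDr 1) !addn1.
by move: dk dk'; rewrite /dvdn => /eqP -> /eqP ->.
Qed.

(** [m.+1] is prime to every prime divisor of [m], and -1 is prime to every modulus. *)
Lemma split_exponent_coprime N k : 0 < N -> split_exponent m N k -> coprime k N.
Proof.
move=> N0 [Ek dk]; rewrite -(partnC pi N0) coprimeMr; apply/andP; split.
  rewrite -coprime_modl Ek coprime_modl.
  have [->|m_gt0] := posnP m; first by rewrite coprime1n.
  rewrite coprime_sym; apply: (pnat_coprime (part_pnat _ _)).
  by rewrite -coprime_pi' // coprimenS.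
apply: (@coprime_dvdr _ k.+1) => //; exact: coprimenS.
Qed.

End SplitExponent.

Section PowerAutomorphism.
Variables (G : groupType) (s : seq G) (m : nat) (R : set G).
Hypotheses (rig : rigid s) (nR : is_normal_subgroup R) (RT : R `<=` torsion G).
Let F := gen s.
Hypothesis R_cover : forall g, exists2 f, F f & R (f^-1 * g).
Hypothesis abR : forall x y, R x -> R y -> commute x y.
Hypotheses (m_gt0 : 0 < m) (m_even : 2 %| m).
Hypothesis FR_exp : forall x, F x -> R x -> x ^+ m = 1.
Let sR : is_subgroup R := normal_subgroup nR.

(** Raising to split exponents defines an automorphism [a] of [R] that commutes with conjugation and
    fixes F /\ R, so it is the identity by [rigid_extension]. *)
Lemma rigid_power_trivial x : R x -> x ^+ m = 1.
Proof.
have sG1 : is_subgroup [set (1 : G)].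
  by apply: is_subgroupP => // [_ _ -> ->|_ ->]; rewrite ?mulg1 ?invg1.
have /choice[a aP] y : exists z, R y -> exists N k,
    [/\ 0 < N, y ^+ N = 1, split_exponent m N k & z = y ^+ k].
  have [/RT[N N0 yN]|nRy] := pselect (R y); last by exists 1.
  by have [k Nk] := split_exponent_exists m N0; exists (y ^+ k) => _; exists N, k.
(* Two exponents [N] and [N'] of [y] are compared through a split exponent for [N * N']. *)
have aE y N k : R y -> 0 < N -> y ^+ N = 1 -> split_exponent m N k -> a y = y ^+ k.
  move=> Ry N0 yN Nk; have [N' [k' [N'0 yN' Nk' ->]]] := aP y Ry.
  have NN'0 : 0 < N * N' by rewrite muln_gt0 N0.
  have [k2 Nk2] := split_exponent_exists m NN'0.
  have Nk2' : split_exponent m (N' * N) k2 by rewrite mulnC.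
  rewrite -(expg_modn k yN) -(expg_modn k' yN').
  rewrite (split_exponent_unique N0 Nk (split_exponentMl N0 N'0 Nk2)).
  rewrite (split_exponent_unique N'0 Nk' (split_exponentMl N'0 N0 Nk2')).
  by rewrite !expg_modn.
have common y z : R y -> R z -> exists N k,
    [/\ 0 < N, y ^+ N = 1, z ^+ N = 1 & split_exponent m N k].
  move=> /RT[N N0 yN] /RT[N' N'0 zN'].
  have NN'0 : 0 < N * N' by rewrite muln_gt0 N0.
  have [k Nk] := split_exponent_exists m NN'0; exists (N * N')%N, k; split=> //.
    by rewrite expgnA yN expg1n.
  by rewrite mulnC expgnA zN' expg1n.
have a_id : forall y, R y -> a y = y.
  apply: (rigid_extension rig nR R_cover).
  - by move=> y Ry; have [N [k [_ _ _ ->]]] := aP y Ry; apply: (subgroupX _ sR).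
  - move=> y z Ry Rz; have [N [k [N0 yN zN Nk]]] := common y z Ry Rz.
    rewrite (aE y N k) // (aE z N k) // => E; apply: divg1_eq.
    have com : commute y z^-1 by apply/commuteV/abR.
    apply: (subgroup_coprimeX sG1 (split_exponent_coprime N0 Nk)) => /=.
      by rewrite expgMn // expVgn E mulgV.
    by rewrite expgMn // expVgn yN zN mulgV.
  - move=> y Ry; have [N N0 yN] := RT Ry; have [k Nk] := split_exponent_exists m N0.
    have [k0|k_gt0] := posnP k.
      have := split_exponent_coprime N0 Nk; rewrite k0 /coprime gcd0n => /eqP N1.
      have y1 : y = 1 by rewrite -[y]expg1 -[1%N]N1.
      by exists y; rewrite // (aE y N k) // y1 expg1n.
    have [u v Euv _] := egcdnP N k_gt0.
    rewrite (eqP (split_exponent_coprime N0 Nk)) in Euv.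
    exists (y ^+ u); first exact: (subgroupX _ sR).
    rewrite (aE _ N k) //; last first.
    + by rewrite -expgnA mulnC expgnA yN expg1n.
    + exact: (subgroupX _ sR).
    by rewrite -expgnA Euv addn1 expgS mulnC expgnA yN expg1n mulg1.
  - move=> y z Ry Rz; have [N [k [N0 yN zN Nk]]] := common y z Ry Rz.
    have yz := abR Ry Rz.
    rewrite (aE y N k) // (aE z N k) // (aE (y * z) N k) ?expgMn //.
      exact: (subgroupM sR).
    by rewrite yN zN mulg1.
  - move=> y f Ry Ff; have [N [k [N0 yN Nk ->]]] := aP y Ry.
    rewrite (aE _ N k) ?conjXg //; first exact: normalJ.
    by rewrite -conjXg yN conj1g.
  (* All prime divisors of [m] lie in \pi(m), so [m.+1] is a split exponent for [m] itself, and it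
     fixes elements of exponent [m]. *)
  - move=> y Ry Fy; rewrite (aE _ m m.+1) ?FR_exp //.
      by rewrite expgS FR_exp // mulg1.
    split=> //; rewrite part_p'nat ?dvd1n //.
    by rewrite pnatNK pnat_pi.
move=> Rx; have [N N0 xN] := RT Rx; pose w := x ^+ (N`_\pi(m)).
(* The order of [w] is prime to [m], hence odd. As [w] is both inverted and fixed by [a],
   [w ^+ 2 = 1]. *)
have w1 : w = 1.
  pose N' := (N`_(\pi(m))^')%N; have N'0 : 0 < N' by apply: part_gt0.
  have wN' : w ^+ N' = 1 by rewrite -expgnA partnC.
  have [k [Ek dk]] := split_exponent_exists m N'0.
  have Rw : R w by apply: (subgroupX _ sR).
  have := a_id w Rw; rewrite (aE w N' k) // => wk.
  apply: (subgroup_coprimeX sG1 (m := 2) (n := N')) => //=.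
    apply: (@pnat_coprime \pi(m)); last exact: part_pnat.
    by rewrite pnatE // mem_primes m_gt0.
  move: dk; rewrite part_pnat_id ?part_pnat // => /dvdnP[q Eq].
  have: w ^+ k.+1 = 1 by rewrite Eq mulnC expgnA wN' expg1n.
  by rewrite expgSr wk.
have := a_id x Rx; rewrite (aE x (N`_\pi(m))%N m.+1) ?part_gt0 //.
  by move/(congr1 ( *%g x^-1)); rewrite expgS mulKg mulVg.
split; first by rewrite part_pnat_id ?part_pnat.
rewrite part_p'nat ?dvd1n // pnatNK; exact: part_pnat.
Qed.

End PowerAutomorphism.

(** * Infinite torsion excludes rigidity *)

Lemma torsion_exponent (G : groupType) (K : set G) : finite_set K -> K `<=` torsion G ->
  exists2 e, 0 < e & forall x, K x -> x ^+ e = 1.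
Proof.
move=> /finite_seqP[ks ->]; elim: ks => [|k ks IHks] sub; first by exists 1%N.
have [|e e0 eP] := IHks; first by move=> x /= xks; apply: sub; rewrite /= inE xks orbT.
have [d d0 kd] : torsion G k by apply: sub; rewrite /= mem_head.
exists (d * e)%N; first by rewrite muln_gt0 d0.
move=> x; rewrite /= inE => /orP[/eqP ->|/eP xe]; first by rewrite expgnA kd expg1n.
by rewrite mulnC expgnA xe expg1n.
Qed.

Theorem not_rigid (G : groupType) (s : seq G) (lnG : locally_nilpotent G) :
  infinite_set (torsion G) ->
  (forall g, exists2 f, gen s f & torsion G (f^-1 * g)) -> ~ rigid s.
Proof.
move=> infT FT0 rig0; pose T := torsion G.
have nT : is_normal_subgroup T := torsion_normal lnG.
have sT := normal_subgroup nT.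
have finK0 := rigid_finite_torsion s lnG.
have [e0 e0_gt0 K0e] := torsion_exponent finK0 (@subIsetr _ _ _).
have [r [r_uniq rF r_cover r_inj]] := rigid_transversal lnG rig0 FT0.
have r_gt0 : 0 < size r.
  by have [x] := r_cover 1 (subgroup1 (gen_subgroup s)); case: (r).
(* The factor 2 makes the exponent even, [size r] is the power in [rigid_norm_power], and [e0]
   ensures that [e0 * m0] has the same prime divisors as [m0]. *)
pose m0 := (2 * size r * e0)%N.
have m0_gt0 : 0 < m0 by rewrite !muln_gt0 r_gt0 e0_gt0.
(* An element of order [p] in the centre of the group generated by [x] and [s] commutes with
   [gen s], hence is central in G. *)
have /choice[z zP] (p : nat) : exists z : G,
    prime p -> (exists x, [/\ T x, x ^+ p = 1 & x <> 1]) ->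
    [/\ z ^+ p = 1, z <> 1 & forall g, commute z g].
  have [[p_pr [x [Tx xp x1]]]|no] :=
      pselect (prime p /\ exists x, [/\ T x, x ^+ p = 1 & x <> 1]); last first.
    by exists 1 => p_pr ex; case: no.
  have [|z [_ zp z1 z_cent]] := nilpotent_central_order (gen_nilpotent (x :: s) lnG)
    (gen_subgroup _) nT p_pr _ xp x1; first by apply: mem_gen; rewrite mem_head.
  exists z => _ _; split=> //; apply: (rigid_fixed_central lnG rig0 FT0) => f Ff.
  have sub : {subset s <= x :: s} by move=> y ys; rewrite inE ys orbT.
  by apply: z_cent; apply: (gen_sub sub).
(* The central elements of order [p], for the finitely many primes [p] dividing [m0], are added to
   [s]. *)
pose s' := s ++
  [seq z p | p <- primes m0 & `[< exists x, [/\ T x, x ^+ p = 1 & x <> 1] >]].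
have zs' x : x \in s' -> x \in s \/ x ^+ m0 = 1 /\ forall g, commute x g.
  rewrite mem_cat => /orP[|/mapP[p]]; first by left.
  rewrite mem_filter mem_primes => /andP[/asboolP ex /and3P[p_pr _ p_m]] ->.
  have [zp _ z_cent] := zP p p_pr ex; right; split=> //.
  by rewrite -(divnK p_m) mulnC expgnA zp expg1n.
have ss' : {subset s <= s'} by move=> x xs; rewrite mem_cat xs.
have FF' := gen_sub ss'; have sF := gen_subgroup s; have sF' := gen_subgroup s'.
(* The new generators are central of exponent [m0], so torsion elements of [gen s'] have exponent
   [e0 * m0]; [m0] itself need not change. *)
have F'E : gen s' `<=` [set x | exists f c,
    [/\ gen s f, c ^+ m0 = 1, forall g, commute c g & x = f * c]].
  apply: gen_min => [|x /zs'[xs|[xm x_cent]]]; last 2 first.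
  - exists x, 1; rewrite expg1n mulg1; split=> //; first exact: mem_gen.
    by move=> g; apply/commute_sym/commute1.
  - by exists 1, x; rewrite mul1g; split=> //; apply: (subgroup1 sF).
  apply: is_subgroupP =>
    [|_ _ [f [c [Ff cm cc ->]]] [h [d [Fh dm dc ->]]]|_ [f [c [Ff cm cc ->]]]].
  - exists 1, 1; rewrite expg1n mulg1; split=> //; first exact: (subgroup1 sF).
    by move=> g; apply/commute_sym/commute1.
  - exists (f * h), (c * d); split; first exact: (subgroupM sF).
    + by rewrite expgMn // cm dm mulg1.
    + by move=> g; apply/commute_sym/commuteM; apply/commute_sym.
    + by rewrite -!mulgA; congr (_ * _); rewrite !mulgA cc.
  - exists f^-1, c^-1; split; first exact: (subgroupV sF).
    + by rewrite expVgn cm invg1.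
    + by move=> g; apply/commute_sym/commuteV/commute_sym.
    + by rewrite -invgM cc.
have FT g : exists2 f, gen s' f & T (f^-1 * g).
  by have [f /FF' Ff Tf] := FT0 g; exists f.
have rig : rigid s' := rigid_sub ss' rig0.
have F_central p : prime p -> p %| m0 -> (exists x, [/\ T x, x ^+ p = 1 & x <> 1]) ->
    exists z, [/\ gen s' z, z ^+ p = 1, z <> 1 & forall g, commute z g].
  move=> p_pr p_m ex; have [zp z1 zc] := zP p p_pr ex; exists (z p); split=> //.
  apply: mem_gen; rewrite mem_cat; apply/orP; right; apply/mapP; exists p => //.
  by rewrite mem_filter mem_primes p_pr m0_gt0 p_m !andbT; apply/asboolP; exact: ex.
have [R [pcR minR]] := exists_minimal_power_cofinite lnG rig m0_gt0 FT F_central.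
have [nR RT _ _] := pcR; have sR := normal_subgroup nR.
have R_cover := power_cofinite_cover lnG rig m0_gt0 FT F_central pcR.
have pi_sub d : 0 < d -> d %| m0 -> {subset \pi(d) <= \pi(m0)}.
  by move=> d0 dm p; rewrite !mem_primes m0_gt0 => /and3P[-> _ /dvdn_trans->].
have abR : forall x y, R x -> R y -> commute x y.
  apply: (minimal_cofinite_abelian lnG rig m0_gt0 FT F_central pcR minR r_gt0).
    by apply: pi_sub; rewrite // /m0 dvdn_mulr // dvdn_mull.
  move=> t Rt tF.
  apply: (rigid_norm_power lnG rig0 FT0 r_uniq rF r_cover r_inj nR RT Rt) => f.
  by move=> /FF'; apply: tF.
pose m := (e0 * m0)%N; have m_gt0 : 0 < m by rewrite muln_gt0 e0_gt0.
have Rm : forall x, R x -> x ^+ m = 1.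
  apply: (rigid_power_trivial rig nR RT R_cover abR m_gt0).
    by rewrite /m /m0 -mulnA dvdn_mull // dvdn_mulr.
  move=> x /F'E [f [c [Ff cm cc ->]]] /RT Tfc.
  have Tf : T f by move: Tfc => /(subgroupMr _ sT); apply; exists m0.
  rewrite expgMn; last exact/commute_sym/cc.
  by rewrite /m expgnA K0e // expg1n mul1g mulnC expgnA cm expg1n.
have R1 x : R x -> x = 1.
  have pi_m : {subset \pi(m) <= \pi(m0)}.
    move=> p; rewrite !mem_primes m0_gt0 => /and3P[p_pr _]; rewrite Euclid_dvdM // p_pr.
    by case/orP => // p_e; rewrite dvdn_mull.
  move=> Rx; have [y Ry] :=
    minimal_cofinite_divisible lnG rig m0_gt0 FT F_central pcR minR m_gt0 pi_m Rx.
  rewrite (Rm _ Ry) invg1 mul1g => R'x.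
  suff : comm_subgroup R R `<=` [set 1] by apply.
  apply: generated_min => [|_ [u [v [Ru Rv ->]]]].
    by apply: is_subgroupP => // [_ _ -> ->|_ ->]; rewrite ?mulg1 ?invg1.
  by apply/eqP/commgP/abR.
apply: infT; apply: sub_finite_set (rigid_finite_torsion s' lnG) => t Tt.
split=> //; have [f Ff /R1 E] := R_cover t.
by rewrite -(mulVKg f t) E mulg1.
Qed.

(** * Continuum many automorphisms *)

Section AutomorphismTree.
Variables (G : groupType) (g : nat -> G) (a b : seq G -> G -> G) (x : seq G -> G).
Hypothesis aK : forall s, cancel (a s) (b s).
Hypothesis bK : forall s, cancel (b s) (a s).
Hypothesis aM : forall s, {morph a s : y z / y * z}.
Hypothesis a_fix : forall s, {in s, a s =1 id}.
Hypothesis a_move : forall s, a s (x s) <> x s.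
Hypothesis g_surj : forall y, exists i, g i = y.

(* The second component lists the images of a point under the inverses of all
   the products that can be formed from the automorphisms chosen so far; adding
   them to the fixed set makes the limits surjective. *)
Fixpoint tree_state k : seq G * (G -> seq G) :=
  if k is k'.+1 then
    let: (s, V) := tree_state k' in
    let V' y := V y ++ map (b s) (V y) in
    (s ++ x s :: flatten [seq V' (g i) | i <- iota 0 k], V')
  else ([::], fun y => [:: y]).

Let S k := (tree_state k).1.
Let V k := (tree_state k).2.
Let S_succ k : S k.+1 = S k ++ x (S k) :: flatten [seq V k.+1 (g i) | i <- iota 0 k.+1].
Proof. by rewrite /S /V /=; case: tree_state. Qed.
Let V_succ k y : V k.+1 y = V k y ++ map (b (S k)) (V k y).
Proof. by rewrite /S /V /=; case: tree_state. Qed.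

(** Later factors are applied first. The factor of index [k] fixes the [k]-th finite set pointwise,
    so values on that set no longer change from stage [k] on. *)
Fixpoint tree_product (e : nat -> bool) k : G -> G :=
  if k is k'.+1 then
    fun y => tree_product e k' (if e k' then a (tree_state k').1 y else y)
  else id.

Fixpoint tree_inverse (e : nat -> bool) k : G -> G :=
  if k is k'.+1 then
    fun y => let z := tree_inverse e k' y in if e k' then b (tree_state k').1 z else z
  else id.

Let P := tree_product.
Let Q := tree_inverse.

Let P_inj e k : injective (P e k).
Proof.
elim: k => [//|k IHk] y z /= /IHk; case: (e k) => //.
exact: (can_inj (aK _)).
Qed.

Let P_morph e k : {morph P e k : y z / y * z}.
Proof.
elim: k => [//|k IHk] y z /=; rewrite -IHk; case: (e k) => //.
by rewrite aM.
Qed.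

Let QK e k : cancel (Q e k) (P e k).
Proof. by elim: k => [//|k IHk] y /=; case: (e k); rewrite ?bK IHk. Qed.

Let Q_V e k y : Q e k y \in V k y.
Proof.
elim: k => [|k IHk]; first exact: mem_head.
rewrite V_succ mem_cat /=; case: (e k); last by rewrite IHk.
by apply/orP; right; apply/map_f.
Qed.

Let Q_S e i k : (i < k)%N -> Q e k (g i) \in S k.
Proof.
case: k => // k lt_ik; rewrite S_succ mem_cat inE; apply/orP; right; apply/orP; right.
apply/flattenP; exists (V k.+1 (g i)); last exact: Q_V.
by apply/mapP; exists i; rewrite // mem_iota.
Qed.

Let S_mono j k : (j <= k)%N -> {subset S j <= S k}.
Proof.
move/subnKC => <-; elim: (k - j)%N => [|i IHi] y; first by rewrite addn0.
by move/IHi; rewrite addnS S_succ mem_cat => ->.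
Qed.

Let g_S i : g i \in S i.+1.
Proof.
suff <- : Q (fun=> false) i.+1 (g i) = g i by apply: Q_S.
by elim: i.+1 => //= k ->.
Qed.

Let S_all y : exists k, y \in S k.
Proof. by have [i <-] := g_surj y; exists i.+1; apply: g_S. Qed.

Let P_stable e j k y : (j <= k)%N -> y \in S j -> P e k y = P e j y.
Proof.
move/subnKC => <-; elim: (k - j)%N => [|i IHi] yS; first by rewrite addn0.
rewrite addnS /= -IHi //; case: (e _) => //; congr P.
by apply: a_fix; apply: S_mono yS; apply: leq_addr.
Qed.

(** The limit at [y] is read off at a stage whose finite set contains [y]. It is onto because the
    preimage of [g i] under the product of stage [i.+1] already lies in the set of that stage. *)
Lemma tree_limit : exists f : (nat -> bool) -> G -> G,
  injective f /\ forall e, automorphisms G (f e).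
Proof.
have /choice[n nP] := S_all; pose f e y := P e (n y) y; exists f.
have fE e k y : y \in S k -> f e y = P e k y.
  move=> yS; have [le_nk|/ltnW le_kn] := leqP (n y) k.
    by rewrite /f (P_stable e le_nk).
  by rewrite /f (P_stable e le_kn).
have f3E e y z t : exists k, [/\ f e y = P e k y, f e z = P e k z & f e t = P e k t].
  exists (maxn (n y) (maxn (n z) (n t))).
  by split; apply: fE; apply: S_mono (nP _); rewrite !leq_max leqnn ?orbT.
split=> [e e' eq_f|e]; last first.
  split; last first.
    by move=> y z; have [k [-> -> ->]] := f3E e y z (y * z); apply: P_morph.
  apply: inj_surj_bijective => [y z|y].
    by have [k [-> -> _]] := f3E e y z y; apply: P_inj.
  have [i <-] := g_surj y; exists (Q e i.+1 (g i)).
  by rewrite (fE e i.+1) ?QK //; apply: Q_S.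
(* At the first index [k] where [e] and [e'] differ, the products so far agree, while exactly one of
   the two next factors moves [x (S k)], a point of [S k.+1]. *)
apply/funext => k; elim/ltn_ind: k => k IHk.
have eq_P : P e k = P e' k.
  elim: k IHk => // k IHk IH; apply/funext => y /=.
  by rewrite IH // IHk // => j lt_jk; apply: IH; apply: ltnW.
have xS : x (S k) \in S k.+1 by rewrite S_succ mem_cat mem_head orbT.
have := congr1 (fun h => h (x (S k))) eq_f; rewrite /= !(fE _ k.+1) //= -/(S k).
rewrite -/(P e' k) -eq_P => /P_inj.
by case: (e k) (e' k) => -[] // E; case: (@a_move (S k)).
Qed.

End AutomorphismTree.

(** * The cardinality of Aut G *)

Lemma not_rigid_continuum (G : groupType) : [set: G] #= [set: nat] ->
  (forall s : seq G, ~ rigid s) -> automorphisms G #= [set: nat -> bool].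
Proof.
move=> cardG nrig.
have /countable_injP[c c_inj] : countable [set: G].
  by rewrite /countable; move: cardG; rewrite card_eq_le => /andP[].
have {}c_inj : injective c by move=> y z; apply: c_inj; rewrite in_setT.
rewrite card_eq_le; apply/andP; split.
  (* The upper bound codes a map by its graph, a set of encoded pairs of naturals. *)
  pose code (f : G -> G) (k : nat) := `[< exists y, k = choice.pickle (c y, c (f y)) >].
  suff /injfunPex[h] : exists2 h : (G -> G) -> nat -> bool,
      set_fun (automorphisms G) [set: nat -> bool] h & set_inj (automorphisms G) h.
    exact: inj_card_le.
  exists code => // f f' _ _ eq_code; apply/funext => y.
  have := congr1 (fun h => h (choice.pickle (c y, c (f y)))) eq_code.
  have -> : code f (choice.pickle (c y, c (f y))) by apply/asboolP; exists y.
  move/esym/asboolP => [z /(pcan_inj choice.pickleK) [/c_inj -> /c_inj]].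
  by [].
(* [g] inverts the injection [c], with arbitrary values outside its image. *)
have /choice[g gK] (i : nat) : exists y : G, forall z, c z = i -> z = y.
  have [[y <-]|no] := pselect (exists y, c y = i); first by exists y => z /c_inj.
  by exists 1 => z zi; case: no; exists z.
have /choice[a aP] (s : seq G) : exists a : G -> G,
    [/\ automorphisms G a, {in s, a =1 id} & exists y, a y <> y].
  apply: contrapT => no; apply: (nrig s) => f autf fs y; apply: contrapT => fy.
  by apply: no; exists f; split=> //; exists y.
have /choice[b bP] (s : seq G) : exists b : G -> G, cancel (a s) b /\ cancel b (a s).
  by have [[[b aK bK] _] _ _] := aP s; exists b.
have /choice[x xP] (s : seq G) : exists y : G, a s y <> y by have [_ _] := aP s.
have [||||||f [f_inj autf]] := @tree_limit G g a b x.
- by move=> s; case: (bP s).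
- by move=> s; case: (bP s).
- by move=> s; case: (aP s) => -[].
- by move=> s; case: (aP s).
- exact: xP.
- by move=> y; exists (c y); apply/esym/gK.
suff /injfunPex[h] : exists2 h : (nat -> bool) -> G -> G,
    set_fun [set: nat -> bool] (automorphisms G) h & set_inj [set: nat -> bool] h.
  exact: inj_card_le.
by exists f => [e _|e e' _ _ /f_inj] //; apply: autf.
Qed.

Theorem corollary3p6 (G : groupType)
    (cardG : [set: G] #= [set: nat])
    (lnG : locally_nilpotent G)
    (inf_torG : infinite_set (torsion G))
    (fgG : finitely_generated [set: quotient_group (torsion_normal lnG)]) :
  automorphisms G #= [set: nat -> bool].
Proof.
apply: not_rigid_continuum => // s rig.
set nT := torsion_normal lnG in fgG.
have [A /finite_seqP[l ->] genA] := fgG.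
(* Representatives of the generators of G / T are added to [s], so that F T = G; the larger set
   stays rigid. *)
pose s' := s ++ map repr l.
apply: (not_rigid (s := s') lnG inf_torG) => [g|]; last first.
  by apply: rigid_sub rig => x xs; rewrite mem_cat xs.
have sF := gen_subgroup s'.
pose H := [set X | exists2 f, gen s' f & quotient_pi nT f = X].
suff [f Ff /quotient_piP] : H (quotient_pi nT g) by exists f.
have : [set: quotient_group nT] (quotient_pi nT g) by [].
rewrite genA; apply: generated_min => [|X /= Xl]; last first.
  exists (repr X); last exact: quotient_reprK.
  by apply: mem_gen; rewrite mem_cat map_f ?orbT.
apply: is_subgroupP => [|X Y [f Ff <-] [h Fh <-]|X [f Ff <-]].
- by exists 1; first exact: (subgroup1 sF).
- exists (f * h); first exact: (subgroupM sF).
  by rewrite -quotient_piM.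
- exists f^-1; first exact: (subgroupV sF).
  by rewrite -quotient_piV.
Qed.
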